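(* Let $X$ and $Y$ be standard Borel spaces, $\mu\in\mathcal P(X)$, $\nu\in\mathcal P(Y)$ and $\pi\in\mathrm{Cpl}(\mu,\nu)$. Then there exists a Borel measurable bijection $T:X\times[0,1]\to Y\times[0,1]$ such that (i) $T_\ast(\mu\otimes\lambda)=\nu\otimes\lambda$, and (ii) writing $\mathrm{pr}_{XY}:X\times[0,1]\times Y\times[0,1]\to X\times Y$ for the projection onto the $X$ and $Y$ coordinates and $\widehat\pi:=(\mathrm{id},T)_\ast(\mu\otimes\lambda)$, one has $(\mathrm{pr}_{XY})_\ast\widehat\pi=\pi$.
   Context: $\lambda$ denotes Lebesgue measure on $[0,1]$; $\mathrm{Cpl}(\mu,\nu)$ is the set of probability measures on $X\times Y$ with marginals $\mu,\nu$; $f_\ast\mu$ denotes the push-forward. Standing assumption: all standard Borel spaces are uncountable. *)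

(* Defs.v *)
From HB Require Import structures.
From mathcomp Require Import all_boot all_order all_algebra.
From mathcomp Require Import all_classical all_reals all_analysis.
Set Implicit Arguments. Unset Strict Implicit. Unset Printing Implicit Defensive.
Import Order.TTheory GRing.Theory Num.Theory.
Local Open Scope classical_set_scope.
Local Open Scope ring_scope.

Definition is_metric (R : realType) (T : Type) (dist : T -> T -> R) : Prop :=
  [/\ forall x y, 0 <= dist x y,
      forall x y, dist x y = 0 <-> x = y,
      forall x y, dist x y = dist y x &
      forall x y z, dist x z <= dist x y + dist y z].

Definition metric_open (R : realType) (T : Type) (dist : T -> T -> R)
  (A : set T) : Prop :=
  forall x, A x -> exists2 e : R, 0 < e & [set y | dist x y < e] `<=` A.

Definition metric_separable (R : realType) (T : Type) (dist : T -> T -> R) :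
  Prop :=
  exists D : set T, countable D /\
    forall x (e : R), 0 < e -> exists2 y, D y & dist x y < e.

Definition metric_complete (R : realType) (T : Type) (dist : T -> T -> R) :
  Prop :=
  forall u : nat -> T,
    (forall e : R, 0 < e -> exists N, forall m n, (N <= m)%N -> (N <= n)%N ->
        dist (u m) (u n) < e) ->
    exists x, forall e : R, 0 < e -> exists N, forall n, (N <= n)%N ->
        dist (u n) x < e.

Definition standard_borel (R : realType) d (T : measurableType d) : Prop :=
  exists dist : T -> T -> R,
    [/\ is_metric dist, metric_separable dist, metric_complete dist &
        (@measurable d T) = <<s metric_open dist >>].

Definition coupling (R : realType) d1 d2 (X : measurableType d1)
  (Y : measurableType d2) (mu : probability X R) (nu : probability Y R)
  (pi : probability (prod X Y) R) : Prop :=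
  (forall A, measurable A -> pushforward pi fst A = mu A) /\
  (forall B, measurable B -> pushforward pi snd B = nu B).

Definition unit_itv (R : realType) : set R := `[0%R, 1%R].
Arguments unit_itv R : clear implicits.
Lemma measurable_unit_itv (R : realType) : measurable (unit_itv R).
Proof. exact: measurable_itv. Qed.
Arguments measurable_unit_itv R : clear implicits.
Definition lambda01 (R : realType) : set R -> \bar R :=
  mrestr (@lebesgue_measure R) (measurable_unit_itv R).
Arguments lambda01 R : clear implicits.

(* Main.v *)
Require Import Defs.
From HB Require Import structures.
From mathcomp Require Import all_boot all_order all_algebra.
From mathcomp Require Import all_classical all_reals all_analysis.
From mathcomp Require Import measurable_realfun ring lra.
Import Order.TTheory GRing.Theory Num.Theory.
Local Open Scope classical_set_scope.
Local Open Scope ring_scope.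

(** Disintegrating [pi] over [mu] and inverting conditional distribution functions
    writes [pi] as the law of [(x, y (x, u))] with [u] uniform.  Encoding [Y * R] in
    the line, the conditional law of [(y, w)] given [x] under [pi \x lambda] becomes
    diffuse, so its distribution function is continuous and a second quantile
    transform is an isomorphism modulo null sets from [mu \x lambda] to
    [pi \x lambda] that preserves [x].  Composing it with the inverse of the
    analogous map for [Y] gives the required map up to null sets.  The exceptional
    sets are enlarged by null copies of the line, into which every standard Borel
    space embeds, and are matched by a measurable Schroeder-Bernstein argument.

    A standard Borel space enters only as a measurable retract of the line, i.e.
    through measurable [f : T -> R] and [g : R -> T] with [g \o f = id]; ranges of
    such [f] are then Borel without any appeal to Lusin-Souslin. *)

Set Implicit Arguments.
Unset Strict Implicit.
Unset Printing Implicit Defensive.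

(** The obstacle is that [T] must be a bijection everywhere although the conditional laws of [pi]
    may have atoms, where a quantile transform is not injective. The extra uniform coordinate [w]
    removes them: for fixed [y], an injective encoding of [(y, w)] takes a given value for at most
    one [w]. A continuous distribution function undoes its own quantile function on the open unit
    interval, which is one of the two cancellations; the other is automatic for maps that transport
    the measures. Property (ii) survives the composition because the first isomorphism keeps [x],
    and the inverse of the second keeps [y] almost surely. The spaces carry a full factor [R], and
    [lambda01] vanishes off the unit interval; the strip over that interval is thus a set of full
    measure, and restricting to it belongs to the final repair. Null copies of the line are inserted
    because the exceptional sets on the two sides could otherwise differ in cardinality: once each
    contains a copy of the whole opposite space, injections exist both ways. *)

(** * Coding Boolean sequences by real numbers *)

Section quaternary_code.
Variable R : realType.
Implicit Types (z : nat -> bool) (t : R).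

Let term z n : R := (z n)%:R / 4 ^+ n.+1.

(** Only the digits 0 and 1 are used in base 4, which avoids the double expansions of base 2. A tail
    is at most 1/2, so a leading 0 gives a value of at most 1/8 and a leading 1 a value of at least
    1/4; comparison with 1/4 reads the digit off. *)
Definition quat_code z : R := fine (\sum_(0 <= n <oo) (term z n)%:E)%E.

Let term_ge0 z n : (0 <= (term z n)%:E)%E.
Proof. by rewrite lee_fin divr_ge0// exprn_ge0. Qed.

Let sum_le z : (\sum_(0 <= n <oo) (term z n)%:E <= (2^-1)%:E :> \bar R)%E.
Proof.
have H : (\sum_(0 <= k <oo) ((2^-1 : R) / (2 ^ (k + 1))%:R)%:E = (2^-1)%:E :> \bar R)%E.
  have /cvg_lim := @cvg_geometric_eseries_half R 2^-1 0.
  by rewrite expr0 divr1; apply.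
rewrite -H; apply: lee_nneseries => [n _ _|n _]; first exact: term_ge0.
rewrite lee_fin /term natrX -exprVn -exprVn addn1.
apply: (@le_trans _ _ (4^-1 ^+ n.+1)); first by case: (z n); rewrite ?mul1r ?mul0r// exprn_ge0.
have -> : (4^-1 : R) = 2^-1 * 2^-1 by lra.
rewrite exprMn ler_wpM2r// ?exprn_ge0// exprS.
by rewrite ler_piMr// exprn_ile1//; lra.
Qed.

Let sum_fin z : (\sum_(0 <= n <oo) (term z n)%:E)%E \is a @fin_num R.
Proof.
rewrite ge0_fin_numE ?(le_lt_trans (sum_le z)) ?ltry//.
by apply: nneseries_ge0 => n _ _; exact: term_ge0.
Qed.

Lemma quat_code_ge0 z : 0 <= quat_code z.
Proof. by apply: fine_ge0; apply: nneseries_ge0 => n _ _; exact: term_ge0. Qed.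

Lemma quat_code_le z : quat_code z <= 2^-1.
Proof. by rewrite -lee_fin fineK. Qed.

Lemma quat_code_rec z :
  quat_code z = ((z 0%N)%:R + quat_code (fun n => z n.+1)) / 4.
Proof.
apply: EFin_inj; rewrite fineK// nneseries_recl//.
rewrite -(nneseries_addn 1)//; under eq_eseriesr => n _.
  rewrite (_ : (term z (n + 1))%:E = ((4^-1)%:E * (term (fun n => z n.+1) n)%:E)%E); last first.
    by rewrite -EFinM /term addn1 [in LHS]exprS invfM; congr (_%:E); ring.
  over.
rewrite nneseriesZl// -[X in (_ * X)%E]fineK// -/(quat_code _).
rewrite -EFinM -EFinD /term expr1; congr _%:E; ring.
Qed.

Fixpoint quat_residue t n : R :=
  if n is n'.+1 then
    4 * quat_residue t n' - (if 4^-1 <= quat_residue t n' then 1 else 0)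
  else t.

Definition quat_digit t n := 4^-1 <= quat_residue t n.

Let quat_digit0 z : (4^-1 <= quat_code z) = z 0%N.
Proof.
rewrite quat_code_rec; have := quat_code_le (fun n => z n.+1).
have := quat_code_ge0 (fun n => z n.+1).
case: (z 0%N) => ? ?; [apply/idP|apply/negbTE; rewrite -ltNge]; rewrite ?mulr1n ?mulr0n; lra.
Qed.

Lemma quat_codeK z n : quat_digit (quat_code z) n = z n.
Proof.
have H : quat_residue (quat_code z) n = quat_code (fun k => z (n + k)%N).
  elim: n => [//|n /= ->]; rewrite quat_digit0.
  rewrite quat_code_rec addn0 mulrCA mulfV// mulr1.
  under [in RHS]eq_fun do rewrite addSnnS.
  by case: (z n) => /=; rewrite ?mulr1n ?mulr0n ?subr0 ?add0r // addrC addKr.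
by rewrite /quat_digit H quat_digit0 addn0.
Qed.

Lemma measurable_quat_digit n : measurable_fun setT (quat_digit^~ n).
Proof.
suff H : measurable_fun setT (quat_residue^~ n) by exact: measurable_fun_ler.
elim: n => [|n IH] /=; first exact: measurable_id.
apply: measurable_funB; first exact: measurable_funM.
by apply: measurable_fun_ifT => //; exact: measurable_fun_ler.
Qed.

Lemma measurable_quat_code d (T : measurableType d) (z : T -> nat -> bool) :
  (forall n, measurable_fun setT (z^~ n)) ->
  measurable_fun setT (fun x => quat_code (z x)).
Proof.
move=> mz; apply: (measurableT_comp (fine_measurable measurableT)).
have := @ge0_emeasurable_sum _ T R setT (fun n x => (term (z x) n)%:E) predT.
apply => [*|n _]; first exact: term_ge0.
apply/measurable_EFinP; apply: measurable_funM => //.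
rewrite (_ : (fun _ => _) = fun x => if z x n then 1 else 0); last first.
  by apply/funext => x; case: (z x n).
exact: measurable_fun_ifT.
Qed.

End quaternary_code.

(** * Measurability of predicates built from countable quantifiers *)

Section measurable_predicates.
Context d (T : measurableType d).

Lemma measurable_bool_set (b : T -> bool) :
  measurable_fun setT b -> measurable [set x | b x].
Proof. by move=> mb; rewrite -[X in measurable X]setTI; exact: (mb _ [set true]). Qed.

Lemma measurable_preim d' (T' : measurableType d') (f : T -> T') (A : set T') :
  measurable_fun setT f -> measurable A -> measurable (f @^-1` A).
Proof. by move=> mf mA; rewrite -[X in measurable X]setTI; exact: mf. Qed.

Lemma measurable_cst_set (P : Prop) : measurable [set _ : T | P].
Proof.
have [p|np] := pselect P; first by rewrite (_ : mkset _ = setT)//; apply/seteqP; split.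
by rewrite (_ : mkset _ = set0)//; apply/seteqP; split.
Qed.

Lemma measurable_exists (I : countType) (P : I -> T -> Prop) :
  (forall i, measurable [set x | P i x]) -> measurable [set x | exists i, P i x].
Proof.
move=> mP; rewrite (_ : mkset _ = \bigcup_i [set x | P i x]).
  exact: countable_bigcupT_measurable.
by apply/seteqP; split => [x [i ?]|x [i _ ?]]; exists i.
Qed.

Lemma measurable_forall (I : countType) (P : I -> T -> Prop) :
  (forall i, measurable [set x | P i x]) -> measurable [set x | forall i, P i x].
Proof.
move=> mP; rewrite (_ : mkset _ = ~` [set x | exists i, ~ P i x]).
  apply: measurableC; apply: measurable_exists => i.
  exact: (measurableC (mP i)).
apply/seteqP; split => [x Px [i]|x nP i]; first exact.
by apply: contrapT => nPi; apply: nP; exists i.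
Qed.

Lemma measurable_imp (P Q : T -> Prop) :
  measurable [set x | P x] -> measurable [set x | Q x] ->
  measurable [set x | P x -> Q x].
Proof.
move=> mP mQ; rewrite (_ : mkset _ = ~` [set x | P x] `|` [set x | Q x]).
  by apply: measurableU => //; exact: measurableC.
apply/seteqP; split => x /=; last by case.
by have [p /(_ p)|] := pselect (P x); [right|left].
Qed.

Lemma measurable_and_set (P Q : T -> Prop) :
  measurable [set x | P x] -> measurable [set x | Q x] ->
  measurable [set x | P x /\ Q x].
Proof. exact: measurableI. Qed.

Lemma measurable_iff (P Q : T -> Prop) :
  measurable [set x | P x] -> measurable [set x | Q x] ->
  measurable [set x | P x <-> Q x].
Proof. by move=> mP mQ; apply: measurableI; exact: measurable_imp. Qed.

End measurable_predicates.

Section countable_code.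
Variables (R : realType) (I : countType).

Definition code (z : I -> bool) : R :=
  quat_code R (fun n => if unpickle n is Some i then z i else false).

Definition decode (t : R) (i : I) : bool := quat_digit t (pickle i).

Lemma codeK z : decode (code z) = z.
Proof. by apply/funext => i; rewrite /decode quat_codeK pickleK. Qed.

Lemma code_unit z : 0 <= code z <= 1.
Proof.
rewrite quat_code_ge0/=; apply: le_trans (quat_code_le _ _) _.
by rewrite invf_le1// ler1n.
Qed.

Lemma measurable_decode i : measurable_fun setT (decode^~ i).
Proof. exact: measurable_quat_digit. Qed.

Lemma measurable_code d (T : measurableType d) (z : T -> I -> bool) :
  (forall i, measurable_fun setT (z^~ i)) ->
  measurable_fun setT (fun x => code (z x)).
Proof.
move=> mz; apply: measurable_quat_code => n.
by case: (unpickle n) => [i|]; [exact: mz|exact: measurable_cst].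
Qed.

End countable_code.

Definition rational_seq (R : realType) (n : nat) : R :=
  ratr (odflt 0%Q (unpickle n)).

Lemma rational_seq_between (R : realType) (x y : R) :
  x < y -> exists n, x < rational_seq R n < y.
Proof.
move=> /rat_in_itvoo[q]; rewrite in_itv/= => xqy.
by exists (pickle q); rewrite /rational_seq pickleK.
Qed.

(** * Measurable retracts of the real line *)

Definition measurable_retraction d d' (T : measurableType d)
    (U : measurableType d') (f : T -> U) (g : U -> T) :=
  [/\ measurable_fun setT f, measurable_fun setT g & cancel f g].

(** The bound confines the laws pushed to the line to the unit interval, where [cond_quantile] takes
    its values. *)
Definition real_retract (R : realType) d (T : measurableType d) :=
  exists f : T -> R, exists g : R -> T,
    measurable_retraction f g /\ (forall x, 0 <= f x <= 1).

Section retract_of_plane.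
Variable R : realType.

(** Recovers a real number from its lower Dedekind cut. The supremum is taken in the extended reals,
    with value -oo at the rationals outside the cut, so it is total and measurable without side
    conditions. *)
Let cut (z : nat -> bool) : R := fine
  (esups (fun n => if z n then (rational_seq R n)%:E else -oo%E) 0).

Let cutE (x : R) : cut (fun n => rational_seq R n < x) = x.
Proof.
rewrite /cut; set u := (X in esups X); rewrite (_ : esups u 0%N = x%:E)//.
apply/eqP; rewrite eq_le; apply/andP; split.
  apply: ge_ereal_sup => _ [n _ <-]; rewrite /u.
  by case: ifPn => [/ltW|_]; rewrite ?lee_fin ?leNye.
have ub n : (u n <= esups u 0%N)%E by apply: ereal_sup_ubound; exists n.
rewrite leNgt; apply/negP => lt.
case E : (esups u 0%N) ub lt => [s| |] // ub.
  rewrite lte_fin => /rational_seq_between[n /andP[sn nx]].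
  by have := ub n; rewrite /u nx lee_fin leNgt sn.
(* Some rational lies below [x], so the supremum is not -oo; the lower end [x - 1] is arbitrary. *)
move=> _; have [n /andP[_ nx]] := @rational_seq_between R (x - 1) x ltac:(lra).
by have := ub n; rewrite /u nx leeNy_eq.
Qed.

Let measurable_cut d (T : measurableType d) (z : T -> nat -> bool) :
  (forall n, measurable_fun setT (z^~ n)) -> measurable_fun setT (fun x => cut (z x)).
Proof.
move=> mz; apply: (measurableT_comp (fine_measurable measurableT)).
by apply: measurable_fun_esups => n; apply: measurable_fun_ifT.
Qed.

(** Two Dedekind cuts form a single Boolean family indexed by [bool * nat], hence one code. *)
Lemma real_retract_plane : real_retract R (R * R)%type.
Proof.
pose z (p : R * R) (i : bool * nat) :=
  rational_seq R i.2 < (if i.1 then p.1 else p.2).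
pose g (t : R) := (cut (fun n => decode t (true, n)), cut (fun n => decode t (false, n))).
exists (fun p => code R (z p)), g; split; last by move=> ?; exact: code_unit.
split.
- apply: measurable_code => -[[] n]; apply: measurable_fun_ltr => //=.
- apply: measurable_fun_pair; apply: measurable_cut => n; exact: measurable_decode.
- by move=> [x y]; rewrite /g codeK; congr pair; exact: cutE.
Qed.

Lemma real_retractX d1 d2 (T1 : measurableType d1) (T2 : measurableType d2) :
  real_retract R T1 -> real_retract R T2 -> real_retract R (T1 * T2)%type.
Proof.
move=> [f1 [g1 [[mf1 mg1 fg1] _]]] [f2 [g2 [[mf2 mg2 fg2] _]]].
have [f [g [[mf mg fg] f01]]] := real_retract_plane.
exists (fun p => f (f1 p.1, f2 p.2)), (fun t => (g1 (g t).1, g2 (g t).2)).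
split; last by move=> ?; exact: f01.
split.
- apply: measurableT_comp => //; apply: measurable_fun_pair; exact: measurableT_comp.
- apply: measurable_fun_pair; apply: measurableT_comp => //; exact: measurableT_comp.
- by move=> [x y] /=; rewrite fg/= fg1 fg2.
Qed.

(** The identity would be a retraction without the required bound; the detour through the plane
    supplies it. *)
Lemma real_retract_real : real_retract R R.
Proof.
have [f [g [[mf mg fg] f01]]] := real_retract_plane.
exists (fun x => f (x, 0)), (fun t => (g t).1); split => //; split.
- by apply: measurableT_comp => //; apply: measurable_fun_pair => //; exact: measurable_cst.
- exact: measurableT_comp.
- by move=> x; rewrite fg.
Qed.

Lemma measurable_eq_set d d' (T : measurableType d) (U : measurableType d')
    (f g : T -> U) : real_retract R U ->
  measurable_fun setT f -> measurable_fun setT g -> measurable [set x | f x = g x].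
Proof.
move=> [h [k [[mh mk hk] _]]] mf mg.
rewrite (_ : mkset _ = [set x | h (f x) == h (g x)]).
  by apply: measurable_bool_set; apply: measurable_fun_eqr; exact: measurableT_comp.
by apply/seteqP; split => x /= => [->//|/eqP/(can_inj hk)].
Qed.

End retract_of_plane.

(** * Standard Borel spaces as retracts of the line *)

Section standard_borel_retract.
Variable R : realType.

Let rad (k : nat) : R := k.+1%:R^-1.

Let rad_gt0 k : 0 < rad k. Proof. by rewrite /rad invr_gt0. Qed.

Let rad_lt (e : R) : 0 < e -> exists N, forall n, (N <= n)%N -> rad n < e.
Proof.
move=> e0; exists (Num.truncn e^-1) => n len.
rewrite /rad -[ltRHS]invrK ltf_pV2 ?posrE ?invr_gt0//.
by apply: lt_le_trans (truncnS_gt _) _; rewrite ler_nat.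
Qed.

Lemma countable_sub_range (T : pointedType) (D : set T) : countable D ->
  exists s : nat -> T, D `<=` range s.
Proof.
move=> /pfcard_geP[->|[f]]; first by exists (fun=> point).
by exists f => x Dx; have [n _ <-] := @surj _ _ _ _ f x Dx; exists n.
Qed.

Section coding.
Context d (T : measurableType d) (dist : T -> T -> R) (s : nat -> T).
Hypothesis dist_metric : is_metric dist.
Hypothesis dense : forall x (e : R), 0 < e -> exists i, dist x (s i) < e.

Let dist_ge0 x y : 0 <= dist x y. Proof. by case: dist_metric. Qed.
Let dist_eq0 x y : dist x y = 0 -> x = y.
Proof. by case: dist_metric => _ + _ _; move=> /(_ x y)[]. Qed.
Let dist_sym x y : dist x y = dist y x. Proof. by case: dist_metric. Qed.
Let dist_tri y x z : dist x z <= dist x y + dist y z.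
Proof. by case: dist_metric. Qed.

Let dist_small x y : (forall e, 0 < e -> dist x y <= e) -> x = y.
Proof.
move=> H; apply: dist_eq0; apply/eqP; rewrite eq_le dist_ge0 andbT.
by apply/ler_addgt0Pr => e e0; rewrite add0r; exact: H.
Qed.

Let Z x (p : nat * nat) : bool := dist (s p.1) x < rad p.2.

(* By completeness this characterises the range of [Z] by countably many Boolean
   conditions, so that the range is Borel. *)
Let consistent (z : nat * nat -> bool) :=
  [/\ forall k, exists i, z (i, k),
      forall p q, z p -> z q -> dist (s p.1) (s q.1) < rad p.2 + rad q.2 &
      forall p, z p <-> exists q, z q /\ dist (s p.1) (s q.1) + rad q.2 < rad p.2].

Let consistentZ x : consistent (Z x).
Proof.
split=> [k|p q|p]; rewrite /Z.
- have [i xi] := dense x (rad_gt0 k).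
  by exists i; rewrite /= dist_sym.
- move=> px qx; apply: le_lt_trans (dist_tri x _ _) _.
  by rewrite ltrD// dist_sym.
- split=> [px|[q [qx pq]]].
    (* Half of the slack: a ball of radius below [e] whose centre is within [e] of [x] satisfies the
       strict nesting inequality. *)
    pose e := (rad p.2 - dist (s p.1) x) / 2.
    have e0 : 0 < e by rewrite divr_gt0// subr_gt0.
    have [N /(_ N (leqnn _)) Ne] := rad_lt e0.
    have [i xi] := dense x (rad_gt0 N).
    exists (i, N) => /=; split; first by rewrite dist_sym.
    have := dist_tri x (s p.1) (s i); move: Ne; rewrite /e; lra.
  apply: le_lt_trans (dist_tri (s q.1) _ _) _; lra.
Qed.

Let Z_inj x y : Z x = Z y -> x = y.
Proof.
move=> Zxy; apply: dist_small => e e0.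
have [N /(_ N (leqnn _)) Ne] := rad_lt (divr_gt0 e0 (@ltr0Sn R 1)).
have [i xi] := dense x (rad_gt0 N).
have : Z x (i, N) by rewrite /Z/= dist_sym.
rewrite Zxy /Z /= => iy; have := dist_tri (s i) x y; lra.
Qed.

Hypothesis complete : metric_complete dist.

(** The first condition picks a ball of each radius, the second makes their centres a Cauchy
    sequence. In the limit the second condition yields only a weak inequality
    [dist (s q.1) x <= rad q.2]; the third one, strict nesting, restores strictness and also gives
    the converse. *)
Let consistent_ex z : consistent z -> exists x, z = Z x.
Proof.
move=> [exz compat refine].
have [c cz] := choice exz.
have [x cx] : exists x, forall e, 0 < e ->
    exists N, forall n, (N <= n)%N -> dist (s (c n)) x < e.
  apply: complete => e e0.
  have [N NP] := rad_lt (divr_gt0 e0 (@ltr0Sn R 1)).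
  exists N => m n Nm Nn; have := compat _ _ (cz m) (cz n).
  move=> /= /lt_trans; apply; have := NP _ Nm; have := NP _ Nn; lra.
have near e : 0 < e -> exists n, dist (s (c n)) x < e /\ rad n < e.
  move=> e0; have [N1 H1] := cx _ e0; have [N2 H2] := rad_lt e0.
  by exists (maxn N1 N2); rewrite H1 ?H2 ?leq_maxl ?leq_maxr.
have le_rad q : z q -> dist (s q.1) x <= rad q.2.
  move=> zq; apply/ler_addgt0Pr => e e0.
  have [n [nx rn]] := near _ (divr_gt0 e0 (@ltr0Sn R 1)).
  have := compat _ _ zq (cz n) => /= ?.
  have := dist_tri (s (c n)) (s q.1) x; lra.
exists x; apply/funext => p; apply/idP/idP => [/refine[q [zq pq]]|].
  rewrite /Z; apply: le_lt_trans (dist_tri (s q.1) _ _) _.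
  have := le_rad _ zq; lra.
rewrite /Z => px; apply/refine.
pose e := (rad p.2 - dist (s p.1) x) / 2.
have e0 : 0 < e by rewrite divr_gt0// subr_gt0.
have [n [nx rn]] := near _ e0; exists (c n, n); split => //=.
have := dist_tri x (s p.1) (s (c n)); rewrite (dist_sym x).
move: nx rn; rewrite /e; lra.
Qed.

Hypothesis borel : (@measurable d T) = <<s metric_open dist >>.

Let measurable_Z p : measurable [set x | Z x p].
Proof.
rewrite borel; apply: sub_sigma_algebra => x /= px.
exists (rad p.2 - dist (s p.1) x); first by rewrite subr_gt0.
move=> y /= xy; apply: le_lt_trans (dist_tri x _ _) _; lra.
Qed.

Let open_cover (O : set T) : metric_open dist O ->
  O = \bigcup_(p in [set p | [set x | Z x p] `<=` O]) [set x | Z x p].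
Proof.
move=> oO; apply/seteqP; split => [x Ox|x [p pO]]; last exact: pO.
have [e e0 eO] := oO _ Ox.
have [N /(_ N (leqnn _)) Ne] := rad_lt (divr_gt0 e0 (@ltr0Sn R 1)).
have [i xi] := dense x (rad_gt0 N).
exists (i, N); last by rewrite /Z/= dist_sym.
move=> y /= iy; apply: eO => /=; move: iy; rewrite /Z/=.
have := dist_tri (s i) x y; lra.
Qed.

Let measurable_coded : measurable [set t : R | exists x, decode t = Z x].
Proof.
rewrite (_ : mkset _ = [set t | consistent (decode t)]); last first.
  by apply/seteqP; split => t /= => [[x ->]|]; [exact: consistentZ|exact: consistent_ex].
have md (p : nat * nat) : measurable [set t : R | decode t p].
  by apply: measurable_bool_set; exact: measurable_decode.
rewrite (_ : mkset _ = [set t : R | forall k : nat, exists i : nat, decode t (i, k)] `&`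
  [set t : R | forall p q : nat * nat, decode t p -> decode t q -> dist (s p.1) (s q.1) < rad p.2 + rad q.2] `&`
  [set t : R | forall p : nat * nat, decode t p <-> exists q : nat * nat, decode t q /\ dist (s p.1) (s q.1) + rad q.2 < rad p.2]); last first.
  by apply/seteqP; split => t /= => [[]|[[]]].
apply: measurableI; first apply: measurableI.
- apply: measurable_forall => k; apply: measurable_exists => i; exact: md.
- apply: measurable_forall => p; apply: measurable_forall => q.
  apply: measurable_imp (md p) _; apply: measurable_imp (md q) _.
  exact: measurable_cst_set.
- apply: measurable_forall => p; apply: measurable_iff => //.
  apply: measurable_exists => q; apply: measurable_and_set => //.
  exact: measurable_cst_set.
Qed.

Lemma complete_metric_real_retract : real_retract R T.
Proof.
pose f x := code R (Z x).
pose g (t : R) : T := if pselect (exists x, decode t = Z x) is left e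
  then projT1 (cid e) else point.
exists f, g; split; last by move=> x; exact: code_unit.
split.
- apply: measurable_code => p.
  apply: (measurable_fun_bool true); rewrite setTI.
  exact: measurable_Z.
- apply: (measurability _ borel) => _ [V oV <-]; rewrite setTI.
  rewrite (open_cover oV) preimage_bigcup bigcup_mkcond.
  apply: countable_bigcupT_measurable => [//|p].
  case: ifPn => [_|_]; last exact: measurable0.
  (* Off the codes [g] has the default value [point], which accounts for the second piece. *)
  rewrite (_ : _ @^-1` _ =
    [set t : R | (exists x, decode t = Z x) /\ decode t p] `|`
    [set t : R | ~ (exists x, decode t = Z x) /\ Z point p]).
    apply: measurableU; apply: measurable_and_set.
    + exact: measurable_coded.
    + by apply: measurable_bool_set; exact: measurable_decode.
    + exact: (measurableC measurable_coded).
    + exact: measurable_cst_set.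
  apply/seteqP; split => t /=; rewrite /g; case: pselect => e.
  + by case: cid => x /= tx Zx; left; split=> //; rewrite tx.
  + by right.
  + by case: cid => x /= tx [[_ +]|[]//]; rewrite tx.
  + by case=> -[].
- move=> x; rewrite /g; case: pselect => [e|]; last first.
    by case; exists x; rewrite codeK.
  by case: cid => y /=; rewrite codeK => /Z_inj ->.
Qed.

End coding.

Lemma standard_borel_real_retract d (T : measurableType d) :
  standard_borel R T -> real_retract R T.
Proof.
move=> [dist [dm [D [cD dense]] compl borel]].
have [s Ds] := countable_sub_range cD.
apply: (complete_metric_real_retract (s := s) dm _ compl borel) => x e e0.
by have [y /Ds[i _ <-] xy] := dense x e e0; exists i.
Qed.

End standard_borel_retract.

(** * Comparison of finite measures *)

Section lambda01_probability.
Variable R : realType.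

Let m : {measure set _ -> \bar R} :=
  mrestr (@lebesgue_measure R) (measurable_unit_itv R).

Let lambda01_set0 : lambda01 R set0 = 0%E. Proof. exact: (measure0 m). Qed.

Let lambda01_ge0 (A : set R) : (0 <= lambda01 R A)%E.
Proof. exact: (measure_ge0 m). Qed.

Let lambda01_additive : semi_sigma_additive (lambda01 R : set R -> \bar R).
Proof. exact: (@measure_semi_sigma_additive _ _ _ m). Qed.

HB.instance Definition _ := isMeasure.Build _ R R (lambda01 R)
  lambda01_set0 lambda01_ge0 lambda01_additive.

Let lambda01_setT : lambda01 R setT = 1%E.
Proof.
by rewrite /lambda01 /mrestr setTI /unit_itv lebesgue_measure_itv/= lte_fin ltr01 sube0.
Qed.

HB.instance Definition _ :=
  Measure_isProbability.Build _ _ _ (lambda01 R) lambda01_setT.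

Lemma lambda01_le (c : R) : 0 <= c <= 1 -> lambda01 R [set u | u <= c] = c%:E.
Proof.
move=> /andP[c0 c1]; rewrite /lambda01 /mrestr.
rewrite (_ : _ `&` _ = [set` `[0, c]]).
  rewrite lebesgue_measure_itv/= lte_fin; case: ifPn => [_|]; first by rewrite sube0.
  by rewrite -leNgt => c0'; congr _%:E; apply/eqP; rewrite eq_le c0.
apply/seteqP; split => x /=; rewrite /unit_itv /= !in_itv/=.
  by move=> [-> /andP[->]].
by move=> /andP[-> xc]; rewrite xc (le_trans xc).
Qed.

Lemma lambda01_set1 (c : R) : lambda01 R [set c] = 0%E.
Proof.
apply/eqP; rewrite eq_le measure_ge0 andbT.
apply: (@le_trans _ _ (lebesgue_measure [set c])).
  by apply: le_measure; rewrite ?inE//; apply: measurableI => //; exact: measurable_unit_itv.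
by rewrite lebesgue_measure_set1.
Qed.

End lambda01_probability.

Section law.
Context d d' (T : measurableType d) (T' : measurableType d') (R : realType).
Variables (P : probability T R) (f : T -> T') (mf : measurable_fun setT f).

Let f_mfun : {mfun T >-> T'} := HB.pack f (isMeasurableFun.Build _ _ _ _ f mf).

Definition law : probability T' R := distribution P f_mfun.

Lemma lawE A : law A = P (f @^-1` A). Proof. by []. Qed.

End law.

Section measure_comparison.
Variable R : realType.
Local Open Scope ereal_scope.

(** Rays whose endpoints enumerate rationals form a chain but not a monotone sequence. Their partial
    unions are monotone, and each of them equals some [E k], namely the largest set so far, so the
    suprema agree. *)
Lemma measure_bigcup_chain d (T : measurableType d) (m : {measure set T -> \bar R})
    (E : nat -> set T) :
  (forall i, measurable (E i)) -> (forall i j, E i `<=` E j \/ E j `<=` E i) ->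
  m (\bigcup_i E i) = ereal_sup (range (m \o E)).
Proof.
move=> mE chain; pose F n := \big[setU/set0]_(i < n.+1) E i.
have ndF : nondecreasing_seq F.
  apply/nondecreasing_seqP => n; apply/subsetPset.
  by rewrite {2}/F big_ord_recr/=; left.
have EF n : E n `<=` F n by rewrite /F big_ord_recr/=; right.
have FE n : exists k, F n = E k.
  elim: n => [|n [k Fk]]; first by exists 0%N; rewrite /F big_ord1.
  rewrite /F big_ord_recr/= -/(F n) Fk.
  have [|] := chain k n.+1; first by exists n.+1; rewrite setUidr.
  by exists k; rewrite setUidl.
have mF n : measurable (F n) by have [k ->] := FE n.
have -> : \bigcup_i E i = \bigcup_i F i.
  apply/seteqP; split => x [n _ nx]; first by exists n => //; exact: EF.
  by have [k Fk] := FE n; exists k => //; rewrite -Fk.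
have cF : m \o F @ \oo --> m (\bigcup_i F i).
  by apply: nondecreasing_cvg_mu => //; exact: bigcup_measurable.
have cF' : m \o F @ \oo --> ereal_sup (range (m \o F)).
  apply: ereal_nondecreasing_cvgn => i j ij /=.
  by apply: le_measure; rewrite ?inE//; exact/subsetPset/ndF.
rewrite (cvg_unique _ cF cF')//; apply/eqP; rewrite eq_le; apply/andP; split.
  apply: ge_ereal_sup => _ [n _ <-]; apply: ereal_sup_ubound.
  by have [k Fk] := FE n; exists k => //=; rewrite Fk.
apply: ge_ereal_sup => _ [n _ <-]; apply: (@le_trans _ _ (m (F n))).
  by apply: le_measure; rewrite ?inE.
by apply: ereal_sup_ubound; exists n.
Qed.

Lemma measure_eq_rays (m1 m2 : {measure set R -> \bar R}) :
  m1 setT < +oo -> (forall t : R, m1 [set` `]-oo, t[%R] = m2 [set` `]-oo, t[%R]) ->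
  forall B, measurable B -> m1 B = m2 B.
Proof.
move=> fin1 eq12 B mB.
pose G : set (set R) := [set A | exists t : R, A = [set` `]-oo, t[%R]].
apply: (@measure_unique _ R _ G (fun k => [set` `]-oo, k%:R[%R])) => //.
- exact: RGenInftyO.measurableE.
- move=> _ _ [s ->] [t ->]; exists (Num.min s t).
  by apply/seteqP; split => x /=; rewrite !in_itv/= lt_min => /andP.
- by move=> i; exists i%:R.
- apply/seteqP; split => // x _; exists (Num.truncn x).+1 => //=.
  by rewrite in_itv/= truncnS_gt.
- by move=> _ [t ->].
- move=> k; apply: le_lt_trans fin1; apply: le_measure; rewrite ?inE//.
Qed.

Lemma measure_eq_rectangles d1 d2 (T1 : measurableType d1) (T2 : measurableType d2)
    (m1 m2 : {measure set (T1 * T2) -> \bar R}) :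
  m1 setT < +oo ->
  (forall A B, measurable A -> measurable B -> m1 (A `*` B) = m2 (A `*` B)) ->
  forall C, measurable C -> m1 C = m2 C.
Proof.
move=> fin1 eq12 C mC.
pose G := [set A `*` B | A in @measurable _ T1 & B in @measurable _ T2].
apply: (@measure_unique _ R _ G (fun=> setT)) => //.
- exact: measurable_prod_measurableType.
- move=> _ _ [A1 mA1 [B1 mB1 <-]] [A2 mA2 [B2 mB2 <-]].
  exists (A1 `&` A2); first exact: measurableI.
  by exists (B1 `&` B2); [exact: measurableI|rewrite setXI].
- by move=> _; exists setT => //; exists setT => //; rewrite setXTT.
- by rewrite bigcup_const.
- by move=> _ [A mA [B mB <-]]; exact: eq12.
Qed.

(** For fixed [A] both sides are finite measures in the second factor, so rays determine them there;
    rectangles then determine the measures on the product. *)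
Lemma measure_eq_rectangle_rays d1 (T1 : measurableType d1)
    (m1 m2 : {measure set (T1 * R) -> \bar R}) :
  m1 setT < +oo ->
  (forall A (t : R), measurable A ->
    m1 (A `*` [set` `]-oo, t[%R]) = m2 (A `*` [set` `]-oo, t[%R])) ->
  forall C, measurable C -> m1 C = m2 C.
Proof.
move=> fin1 eq12; apply: measure_eq_rectangles => // A B mA mB.
have mAT : measurable (A `*` [set: R]) by exact: measurableX.
have E (m : {measure set (T1 * R) -> \bar R}) B' :
    m (A `*` B') = pushforward (mrestr m mAT) (snd : T1 * R -> R) B'.
  rewrite /pushforward /mrestr; congr (m _).
  by apply/seteqP; split => -[x y] /= => [[]|[? []]].
rewrite !E; apply: measure_eq_rays mB.
- rewrite /= /pushforward /mrestr preimage_setT setTI.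
  by apply: le_lt_trans fin1; apply: le_measure; rewrite ?inE.
- by move=> t /=; rewrite -!E eq12.
Qed.

End measure_comparison.

(** * Isomorphisms modulo null sets and their rectification *)

Section null_embedding.
Variable R : realType.
Local Notation lam := (lambda01 R).

(* The fibres of a measurable surjection of the line onto itself are disjoint
   copies of the line; by Fubini almost all of them are null. *)
Lemma null_real_embedding : exists (k k' : R -> R) (K : set R),
  [/\ measurable_retraction k k', forall t, K (k t), forall t, 0 <= k t <= 1,
      measurable K & lam K = 0%E].
Proof.
have [f [g [[mf mg fg] f01]]] := real_retract_plane R.
pose S : set (R * R) := [set p | (g p.2).1 = p.1].
have mS : measurable S.
  apply: (measurable_eq_set (real_retract_real R)) => //.
  by do 2!apply: measurableT_comp => //.
have int0 : (\int[lam]_c (lam \o xsection S) c = 0)%E.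
  transitivity (\int[lam]_c (lam \o ysection S) c)%E.
    rewrite -(indic_fubini_tonelli_FE lam mS) -(indic_fubini_tonelli_GE lam mS).
    exact: indic_fubini_tonelli.
  apply: integral0_eq => s _ /=; rewrite -(lambda01_set1 (g s).1); congr (lam _).
  by apply/seteqP; split => c; rewrite /ysection /= inE.
have [c c0] : exists c, lam (xsection S c) = 0%E.
  apply: contrapT => nc.
  have mxS := measurable_fun_xsection lam mS.
  have : (\int[lam]_c `|(lam \o xsection S) c| = 0)%E.
    by rewrite -int0; apply: eq_integral => c _; rewrite gee0_abs.
  move=> /(ae_eq_integral_abs lam measurableT mxS)[N [mN N0 sub]].
  have : lam setT = 0%E.
    apply/eqP; rewrite eq_le measure_ge0 andbT -N0.
    apply: le_measure; rewrite ?inE// => c _; apply: sub => /= /(_ Logic.I) c0.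
    by apply: nc; exists c.
  by move/eqP; rewrite probability_setT onee_eq0.
exists (fun t => f (c, t)), (fun s => (g s).2), (xsection S c); split => //.
- split; [|exact: measurableT_comp|by move=> t; rewrite fg].
  by apply: measurableT_comp => //; exact: measurable_fun_pair.
- by move=> t; rewrite /xsection /= inE /S /= fg.
- exact: measurable_xsection.
Qed.

End null_embedding.

Section schroeder_bernstein.
Context (R : realType) d d' (S : measurableType d) (S' : measurableType d').
Hypothesis retS : real_retract R S.
Variables (i : S -> S') (i' : S' -> S) (j : S' -> S) (j' : S -> S').
Hypothesis reti : measurable_retraction i i'.
Hypothesis retj : measurable_retraction j j'.
Variables (N : set S) (M : set S') (mN : measurable N) (mM : measurable M).
Hypothesis iNM : forall p, N p -> M (i p).
Hypothesis jMN : forall p, M p -> N (j p).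

(** [E] is the orbit under [j \o i] of the part of [N] missed by [j]; the bijection is [i] on [E]
    and the inverse of [j] elsewhere. The retractions make images Borel: a point lies in the image
    of an injection with left inverse exactly when going back and forth fixes it, and its preimage
    is then known. *)
Lemma measurable_schroeder_bernstein :
  exists T : S -> S', measurable_fun setT T /\ set_bij N M T.
Proof.
have [mi mi' iK] := reti; have [mj mj' jK] := retj.
pose E0 := N `\` [set p | M (j' p) /\ j (j' p) = p].
have mE0 : measurable E0.
  apply: measurableD => //; apply: measurableI; first exact: measurable_preim.
  by apply: (measurable_eq_set retS) => //; exact: measurableT_comp.
pose k n := iter n (j \o i); pose k' n := iter n (i' \o j').
have mk n : measurable_fun setT (k n).
  by elim: n => [|n IH]; [exact: measurable_id|do 2!apply: measurableT_comp => //].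
have mk' n : measurable_fun setT (k' n).
  by elim: n => [|n IH]; [exact: measurable_id|do 2!apply: measurableT_comp => //].
have kK n : cancel (k n) (k' n).
  by elim: n => [//|n IH] p; rewrite /k' iterSr /k iterS/= jK iK; exact: IH.
pose E := [set p | exists n, E0 (k' n p) /\ k n (k' n p) = p].
have EP p : E p <-> exists n p0, E0 p0 /\ p = k n p0.
  split=> [[n [E0p kp]]|[n [p0 [E0p ->]]]]; first by exists n, (k' n p).
  by exists n; rewrite kK.
have mE : measurable E.
  apply: measurable_exists => n; apply: measurableI; first exact: measurable_preim.
  by apply: (measurable_eq_set retS) => //; exact: measurableT_comp.
have kN n p : N p -> N (k n p).
  by move=> Np; elim: n => [//|n IH]; apply: jMN; exact: iNM.
have EN p : E p -> N p by move=> /EP[n [p0 [[Np0 _] ->]]]; exact: kN.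
have ji_E p : E p -> E (j (i p)).
  by move=> /EP[n [p0 [E0p ->]]]; apply/EP; exists n.+1, p0.
have nE p : N p -> ~ E p -> M (j' p) /\ j (j' p) = p.
  move=> Np nEp; apply: contrapT => H; apply: nEp; apply/EP; by exists 0%N, p.
pose T p := if p \in E then i p else j' p.
exists T; split.
  apply: measurable_fun_ifT => //.
  apply: (measurable_fun_bool true); rewrite setTI (_ : _ @^-1` _ = E)//.
  by apply/seteqP; split => x => [/set_mem//|xE]; exact: mem_set.
have TE p : E p -> T p = i p by move=> Ep; rewrite /T mem_set.
have TnE p : ~ E p -> T p = j' p by move=> Ep; rewrite /T memNset.
split.
- move=> p Np; have [Ep|Ep] := pselect (E p); first by rewrite TE//; exact: iNM.
  by rewrite TnE//; have [] := nE _ Np Ep.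
- move=> p p' /set_mem Np /set_mem Np'.
  have cross x x' : N x' -> E x -> ~ E x' -> i x = j' x' -> False.
    move=> Nx' Ex Ex' eq; have [_ jx'] := nE _ Nx' Ex'.
    by apply: Ex'; rewrite -jx' -eq; exact: ji_E.
  have [Ep|Ep] := pselect (E p); have [Ep'|Ep'] := pselect (E p').
  + by rewrite !TE// => /(can_inj iK).
  + by rewrite TE// TnE// => /cross-/(_ Np' Ep Ep').
  + by rewrite TnE// TE// => /esym/cross-/(_ Np Ep' Ep).
  + rewrite !TnE// => eq; have [_ <-] := nE _ Np Ep; have [_ <-] := nE _ Np' Ep'.
    by rewrite eq.
- move=> m Mm; have [Em|Em] := pselect (E (j m)); last first.
    by exists (j m); [exact: jMN|rewrite TnE// jK].
  (* The orbit index 0 is impossible, since [j m] lies in the image of [M], which [E0] omits. So the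
     last application of [j \o i] can be undone, and [i] reaches [m]. *)
  have [[|n] [p0 [E0p eq]]] := (EP _).1 Em.
    by case: E0p => _ []; move: eq; rewrite /k/= => <-; rewrite jK.
  have Ek : E (k n p0) by apply/EP; exists n, p0.
  exists (k n p0); first exact: EN.
  by rewrite TE//; apply: (can_inj jK); rewrite eq.
Qed.

End schroeder_bernstein.

Section ae_isomorphisms.
Variable R : realType.

Lemma measure_eq_mod_null d (T : measurableType d) (P : probability T R) (N A B : set T) :
  measurable N -> P N = 0%E -> measurable A -> measurable B ->
  (forall p, ~ N p -> A p <-> B p) -> P A = P B.
Proof.
move=> mN N0 mA mB AB.
have le C D : measurable C -> measurable D -> (forall p, ~ N p -> C p -> D p) ->
    (P C <= P D)%E.
  move=> mC mD CD; rewrite -[leRHS]adde0 -N0; apply: le_trans (measureU2 _ mD mN).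
  apply: le_measure; rewrite ?inE//; first exact: measurableU.
  by move=> p Cp; have [|nNp] := pselect (N p); [right|left; exact: CD].
by apply/eqP; rewrite eq_le !le// => p /AB[].
Qed.

Lemma null_sub d (T : measurableType d) (P : probability T R) (A B : set T) :
  measurable A -> measurable B -> P B = 0%E -> A `<=` B -> P A = 0%E.
Proof.
by move=> mA mB B0 AB; apply/eqP; rewrite eq_le measure_ge0 andbT -B0 le_measure ?inE.
Qed.

Lemma null_setU d (T : measurableType d) (P : probability T R) (A B : set T) :
  measurable A -> measurable B -> P A = 0%E -> P B = 0%E -> P (A `|` B) = 0%E.
Proof.
move=> mA mB A0 B0; apply/eqP; rewrite eq_le measure_ge0 andbT.
by apply: le_trans (measureU2 _ mA mB) _; rewrite [X in (X + _)%E]A0 add0e [leLHS]B0.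
Qed.

(** One cancellation is enough: pulled back along [f], the set where the other fails lies inside the
    set where this one fails, and [f] transports the measures. *)
Definition ae_iso d d' (S : measurableType d) (S' : measurableType d')
    (P : probability S R) (P' : probability S' R) (f : S -> S') (f' : S' -> S) :=
  [/\ measurable_fun setT f, measurable_fun setT f',
      forall C, measurable C -> P (f @^-1` C) = P' C &
      P [set p | f' (f p) <> p] = 0%E].

Lemma measurable_neq_set d d' (S : measurableType d) (S' : measurableType d')
    (f : S -> S') (f' : S' -> S) : real_retract R S ->
  measurable_fun setT f -> measurable_fun setT f' -> measurable [set p | f' (f p) <> p].
Proof.
move=> retS mf mf'; apply: measurableC; apply: (measurable_eq_set retS).
  exact: measurableT_comp mf' mf.
exact: measurable_id.
Qed.

Lemma ae_iso_sym d d' (S : measurableType d) (S' : measurableType d')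
    (P : probability S R) (P' : probability S' R) (f : S -> S') (f' : S' -> S) :
  real_retract R S -> real_retract R S' -> ae_iso P P' f f' -> ae_iso P' P f' f.
Proof.
move=> retS retS' [mf mf' fP f'f].
have mN := measurable_neq_set retS mf mf'; have mN' := measurable_neq_set retS' mf' mf.
split=> // [C mC|].
- have mf'C : measurable (f' @^-1` C) by exact: measurable_preim.
  rewrite -fP//; apply: (measure_eq_mod_null mN f'f) => //; first exact: measurable_preim.
  by move=> p /contrapT /= ->.
- rewrite -fP//; apply: (null_sub _ mN) => //; first exact: measurable_preim.
  by move=> p /= nE E; apply: nE; rewrite E.
Qed.

Lemma ae_iso_comp d d' d'' (S : measurableType d) (S' : measurableType d')
    (S'' : measurableType d'') (P : probability S R) (P' : probability S' R)
    (P'' : probability S'' R) f f' g g' :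
  real_retract R S -> real_retract R S' ->
  ae_iso P P' f f' -> ae_iso P' P'' g g' -> ae_iso P P'' (g \o f) (f' \o g').
Proof.
move=> retS retS' [mf mf' fP f'f] [mg mg' gP g'g].
have mgf : measurable_fun setT (g \o f) by exact: measurableT_comp.
have mfg' : measurable_fun setT (f' \o g') by exact: measurableT_comp.
have mN := measurable_neq_set retS mf mf'; have mN' := measurable_neq_set retS' mg mg'.
have mfN' := measurable_preim mf mN'.
split=> // [C mC|].
- by rewrite comp_preimage fP ?gP//; exact: measurable_preim.
- apply: (@null_sub _ _ _ _ ([set p | f' (f p) <> p] `|` f @^-1` [set p | g' (g p) <> p])).
  + exact: measurable_neq_set.
  + exact: measurableU.
  + by apply: null_setU => //; rewrite fP.
  + move=> p /= ne; have [E|] := pselect (g' (g (f p)) = f p); last by right.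
    by left; rewrite E in ne.
Qed.

Section rectification.
Context d d' (S : measurableType d) (S' : measurableType d').
Hypotheses (retS : real_retract R S) (retS' : real_retract R S').
Variables (P : probability S R) (P' : probability S' R) (f : S -> S') (f' : S' -> S).
Hypothesis iso : ae_iso P P' f f'.
Variables (D : set S) (D' : set S') (mD : measurable D) (mD' : measurable D').
Hypotheses (D0 : P (~` D) = 0%E) (D'0 : P' (~` D') = 0%E).
Variables (C : set S) (C' : set S') (mC : measurable C) (mC' : measurable C').
Hypotheses (C0 : P C = 0%E) (C'0 : P' C' = 0%E).
Variables (i : S -> S') (i' : S' -> S) (j : S' -> S) (j' : S -> S').
Hypothesis reti : measurable_retraction i i'.
Hypothesis retj : measurable_retraction j j'.
Hypothesis iD' : forall p, D' (i p) /\ C' (i p).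
Hypothesis jD : forall p, D (j p) /\ C (j p).

(** On [A] the map [f] is already a bijection onto [B]. Since [C] and [C'] are cut out of [A] and
    [B], the leftovers [D] minus [A] and [D'] minus [B] receive all of [S'] through [j] and all of
    [S] through [i]; Schroeder-Bernstein matches them, and this changes [f] on a null set only. *)
Lemma ae_iso_rectify : exists (T : S -> S') (N : set S),
  [/\ measurable_fun setT T, set_bij D D' T, measurable N, P N = 0%E &
      forall p, ~ N p -> T p = f p].
Proof.
have [mf mf' fP f'f] := iso.
pose A := [set p | D p /\ ~ C p] `&` f @^-1` [set p | D' p /\ ~ C' p]
          `&` [set p | f' (f p) = p].
pose B := [set p | D' p /\ ~ C' p] `&` f' @^-1` [set p | D p /\ ~ C p]
          `&` [set p | f (f' p) = p].
have mDC : measurable [set p | D p /\ ~ C p] by exact: measurableD.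
have mDC' : measurable [set p | D' p /\ ~ C' p] by exact: measurableD.
have mA : measurable A.
  apply: measurableI; first by apply: measurableI => //; exact: measurable_preim.
  by rewrite -[mkset _]setCK; apply: measurableC; exact: measurable_neq_set.
have mB : measurable B.
  apply: measurableI; first by apply: measurableI => //; exact: measurable_preim.
  by rewrite -[mkset _]setCK; apply: measurableC; exact: measurable_neq_set.
have fA p : A p -> B (f p).
  by move=> [[[Dp Cp] [Dfp Cfp]] /= E]; do !split => //=; rewrite E.
have f'B p : B p -> A (f' p).
  by move=> [[[Dp Cp] [Dfp Cfp]] /= E]; do !split => //=; rewrite E.
have [T1 [mT1 [T1fun T1inj T1surj]]] : exists T : S -> S',
    measurable_fun setT T /\ set_bij (D `\` A) (D' `\` B) T.
  apply: (measurable_schroeder_bernstein retS reti retj); try exact: measurableD.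
  - by move=> p _; have [? Cp] := iD' p; split => // -[[[]]].
  - by move=> p _; have [? Cp] := jD p; split => // -[[[]]].
pose T p := if p \in A then f p else T1 p.
have TA p : A p -> T p = f p by move=> Ap; rewrite /T mem_set.
have TnA p : ~ A p -> T p = T1 p by move=> Ap; rewrite /T memNset.
exists T, (~` A); split.
- apply: measurable_fun_ifT => //.
  apply: (measurable_fun_bool true); rewrite setTI (_ : _ @^-1` _ = A)//.
  by apply/seteqP; split => x => [/set_mem//|xE]; exact: mem_set.
- split.
  + move=> p Dp; have [Ap|Ap] := pselect (A p).
      by rewrite TA//; have [[[]]] := fA _ Ap.
    by rewrite TnA//; have [] := T1fun p (conj Dp Ap).
  + move=> p p' /set_mem Dp /set_mem Dp'.
    have cross x x' : A x -> D x' -> ~ A x' -> f x = T1 x' -> False.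
      move=> Ax Dx' Ax' eq; have [_] := T1fun x' (conj Dx' Ax'); apply.
      by rewrite -eq; exact: fA.
    have [Ap|Ap] := pselect (A p); have [Ap'|Ap'] := pselect (A p').
    * by rewrite !TA// => eq; case: Ap Ap' => _ /= <- [_ /= <-]; rewrite eq.
    * by rewrite TA// TnA// => /cross-/(_ Ap Dp' Ap').
    * by rewrite TnA// TA// => /esym/cross-/(_ Ap' Dp Ap).
    * by rewrite !TnA//; apply: T1inj; exact: mem_set.
  + move=> m D'm; have [Bm|Bm] := pselect (B m).
      exists (f' m); first by have [[[]]] := f'B _ Bm.
      by rewrite TA; [case: Bm|exact: f'B].
    have [p [Dp Ap] <-] := T1surj m (conj D'm Bm).
    by exists p => //; rewrite TnA.
- exact: measurableC.
- have mnDC : measurable (~` D `|` C) by apply: measurableU => //; exact: measurableC.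
  have mnDC' : measurable (~` D' `|` C') by apply: measurableU => //; exact: measurableC.
  have mfnDC' := measurable_preim mf mnDC'.
  have mN := measurable_neq_set retS mf mf'.
  apply: (@null_sub _ _ _ _ ((~` D `|` C) `|` f @^-1` (~` D' `|` C') `|`
                            [set p | f' (f p) <> p])).
  + exact: measurableC.
  + by do 2!apply: measurableU => //.
  + apply: null_setU => //; first by apply: measurableU.
    apply: null_setU => //; first by apply: null_setU => //; exact: measurableC.
    by rewrite fP//; apply: null_setU => //; exact: measurableC.
  + move=> p nAp; apply: contrapT => H; apply: nAp.
    have [Dp|] := pselect (D p); last by move=> ?; case: H; left; left; left.
    have [Cp|Cp] := pselect (C p); first by case: H; left; left; right.
    have [Dfp|] := pselect (D' (f p)); last by move=> ?; case: H; left; right; left.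
    have [Cfp|Cfp] := pselect (C' (f p)); first by case: H; left; right; right.
    split; first by split.
    by apply: contrapT => ne; case: H; right.
- by move=> p /contrapT Ap; exact: TA.
Qed.

End rectification.
End ae_isomorphisms.

(** * Conditional quantiles *)

Section conditional_quantile.
Context (R : realType) d (X : measurableType d) (h : nat -> X -> R).
Local Notation q := (rational_seq R).

Let candidate n (p : X * R) : R := if p.2 <= h n p.1 then Num.max 0 (q n) else 1.

(* [h n x] plays the role of the conditional distribution function given [x] at
   the [n]-th rational; the clamping to [0, 1] keeps the infimum finite. *)
Definition cond_quantile (p : X * R) : R := infs (candidate^~ p) 0%N.

Let candidate_ge0 n p : 0 <= candidate n p.
Proof. by rewrite /candidate; case: ifPn => // _; rewrite le_max lexx. Qed.

Let cond_quantile_le_candidate n p : cond_quantile p <= candidate n p.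
Proof.
apply: ge_inf; last by exists n.
by exists 0 => _ [m _ <-].
Qed.

Lemma cond_quantile_le n x u : u <= h n x -> cond_quantile (x, u) <= Num.max 0 (q n).
Proof. by move=> uh; have := cond_quantile_le_candidate n (x, u); rewrite /candidate uh. Qed.

(** The range of [t] neutralises the clamping: [t <= 1] excludes the default candidate 1, and
    [0 < t] makes the maximum with 0 harmless. *)
Lemma cond_quantile_ltP x u t : 0 < t -> t <= 1 ->
  cond_quantile (x, u) < t <-> exists n, q n < t /\ u <= h n x.
Proof.
move=> t0 t1; split=> [lt|[n [nt uh]]]; last first.
  by apply: le_lt_trans (cond_quantile_le uh) _; rewrite gt_max t0.
have [_ [n _ <-]] : exists2 y, sdrop (candidate^~ (x, u)) 0%N y & y < t.
  by apply: inf_lt lt; exists (candidate 0%N (x, u)), 0%N.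
rewrite /candidate/=; case: ifPn => [uh|_]; last by rewrite ltNge t1.
by rewrite gt_max => /andP[_ nt]; exists n.
Qed.

Hypothesis h01 : forall n x, 0 <= h n x <= 1.

Lemma cond_quantile_ge0 p : 0 <= cond_quantile p.
Proof.
by apply: lb_le_inf; [exists (candidate 0%N p), 0%N|move=> _ [n _ <-]].
Qed.

Lemma cond_quantile_le1 p : 0 <= cond_quantile p <= 1.
Proof.
rewrite cond_quantile_ge0/=.
have [n /andP[n0 n1]] := @rational_seq_between R 0 1 ltr01.
apply: le_trans (cond_quantile_le_candidate n p) _; rewrite /candidate.
by case: ifPn => // _; rewrite ge_max ler01 ltW.
Qed.

Hypothesis mh : forall n, measurable_fun setT (h n).

Lemma measurable_cond_quantile : measurable_fun setT cond_quantile.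
Proof.
apply: measurable_fun_infs => [p _|n]; first by exists 0 => _ [n _ <-].
rewrite /candidate; apply: measurable_fun_ifT => //; apply: measurable_fun_ler => //.
exact: measurableT_comp.
Qed.

Hypothesis h_mono : forall m n x, q m <= q n -> h m x <= h n x.
Variables (mu : probability X R) (rho : probability (X * R)%type R).
Hypothesis rho_fst : forall A, measurable A -> rho (A `*` setT) = mu A.
Hypothesis rho01 : rho (setT `*` ~` [set` `[0, 1]]) = 0%E.
Hypothesis rho_h : forall n A, measurable A ->
  rho (A `*` [set` `]-oo, q n]]) = (\int[mu]_(x in A) (h n x)%:E)%E.

Lemma measurable_fun_quantile_graph :
  measurable_fun setT (fun p : X * R => (p.1, cond_quantile p)).
Proof. by apply: measurable_fun_pair => //; exact: measurable_cond_quantile. Qed.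

(** Together with [above_full], this settles the levels outside the range of [cond_quantile_ltP],
    where only the support of [rho] matters. *)
Let below_null (A : set X) t : measurable A -> t <= 0 ->
  rho (A `*` [set` `]-oo, t[]) = 0%E.
Proof.
move=> mA t0; apply/eqP; rewrite eq_le measure_ge0 andbT -rho01.
apply: le_measure; rewrite ?inE; [exact: measurableX|by apply: measurableX => //; exact: measurableC|].
move=> [x y] [_ /=]; rewrite !in_itv/= => yt; split => //= /andP[y0 _].
by move: (lt_le_trans yt t0); rewrite ltNge y0.
Qed.

Let above_full (A : set X) t : measurable A -> 1 < t ->
  rho (A `*` [set` `]-oo, t[]) = mu A.
Proof.
move=> mA t1; rewrite -rho_fst//; apply/eqP; rewrite eq_le; apply/andP; split.
  by apply: le_measure; rewrite ?inE; [exact: measurableX|exact: measurableX|move=> [x y] []].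
have mC : measurable ((setT : set X) `*` ~` [set` `[(0:R), 1]]).
  by apply: measurableX => //; exact: measurableC.
rewrite -[leRHS]adde0 -rho01.
have mB : measurable (A `*` [set` `]-oo, t[]) by exact: measurableX.
apply: le_trans (measureU2 rho mB mC).
apply: le_measure; rewrite ?inE; [exact: measurableX|by apply: measurableU => //; exact: measurableX|].
move=> [x y] [/= Ax _]; have [yt|ty] := ltP y t; first by left; rewrite /= in_itv.
right; split => //=; rewrite in_itv/= => /andP[_ y1].
by move: (lt_le_trans t1 ty); rewrite ltNge y1.
Qed.

Let Psi (p : X * R) := (p.1, cond_quantile p).

Let subgraph_measure n (A : set X) : measurable A ->
  (mu \x lambda01 R)%E [set p | A p.1 /\ p.2 <= h n p.1] =
  rho (A `*` [set` `]-oo, q n]]).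
Proof.
move=> mA; rewrite rho_h// /product_measure1 [RHS]integral_mkcond.
apply: eq_integral => x _ /=; rewrite patchE; case: ifPn => [|] xA.
  rewrite -lambda01_le//; congr (lambda01 R _).
  apply/seteqP; split => u /=; rewrite /xsection/= inE/=; first by case.
  by rewrite inE in xA.
rewrite -[RHS](measure0 (lambda01 R)); congr (lambda01 R _).
apply/seteqP; split => u //=; rewrite /xsection/= inE/= => -[Ax _].
by move: xA; rewrite notin_setE.
Qed.

Let measurable_subgraph n (A : set X) : measurable A ->
  measurable [set p : X * R | A p.1 /\ p.2 <= h n p.1].
Proof.
move=> mA; apply: measurableI.
  exact: (measurable_preim (f := fst)).
apply: measurable_bool_set; apply: measurable_fun_ler => //.
exact: measurableT_comp.
Qed.

(* The strict inequality in [A `*` ]-oo, t[] makes both sides suprema along a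
   countable chain, so no right-continuous version of [h] is needed. *)
Let middle (A : set X) t : measurable A -> 0 < t -> t <= 1 ->
  (mu \x lambda01 R)%E (Psi @^-1` (A `*` [set` `]-oo, t[])) =
  rho (A `*` [set` `]-oo, t[]).
Proof.
move=> mA t0 t1.
pose E n : set (X * R) := if q n < t then [set p | A p.1 /\ p.2 <= h n p.1] else set0.
pose F n : set (X * R) := if q n < t then A `*` [set` `]-oo, q n]] else set0.
have -> : Psi @^-1` (A `*` [set` `]-oo, t[]) = \bigcup_n E n.
  apply/seteqP; split => [[x u] /= [/= Ax]|[x u] [n _]]; rewrite ?in_itv/=.
    move=> /(cond_quantile_ltP _ _ t0 t1)[n [nt uh]].
    by exists n => //; rewrite /E nt.
  rewrite /E; case: ifPn => // nt [/= Ax uh]; split => //=.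
  by rewrite in_itv/=; apply/(cond_quantile_ltP _ _ t0 t1); exists n.
have -> : A `*` [set` `]-oo, t[] = \bigcup_n F n.
  apply/seteqP; split => [[x u] /= [/= Ax]|[x u] [n _]]; rewrite ?in_itv/=.
    move=> /rational_seq_between[n /andP[un nt]].
    by exists n => //; rewrite /F nt; split => //=; rewrite in_itv/= ltW.
  rewrite /F; case: ifPn => // nt [/= Ax]; rewrite in_itv/= => un; split => //=.
  by rewrite in_itv/= (le_lt_trans un).
have mE n : measurable (E n).
  by rewrite /E; case: ifPn => // _; exact: measurable_subgraph.
have mF n : measurable (F n) by rewrite /F; case: ifPn => // _; exact: measurableX.
rewrite [LHS]measure_bigcup_chain//; last first.
  move=> m n; rewrite /E; case: ifPn => _; last by left.
  case: ifPn => _; last by right.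
  have [mn|/ltW nm] := leP (q m) (q n); [left|right] => -[x u] /= [Ax uh];
    by split => //; apply: le_trans uh (h_mono _ _).
rewrite [RHS]measure_bigcup_chain//; last first.
  move=> m n; rewrite /F; case: ifPn => _; last by left.
  case: ifPn => _; last by right.
  have [mn|/ltW nm] := leP (q m) (q n); [left|right] => -[x u] /= [Ax /=];
    by rewrite in_itv/= => uq; split => //=; rewrite in_itv/= (le_trans uq).
have EF n : (mu \x lambda01 R)%E (E n) = rho (F n).
  by rewrite /E /F; case: ifPn => _; [exact: subgraph_measure|rewrite !measure0].
by congr ereal_sup; apply/seteqP; split => _ [n _ <-]; exists n => //=; rewrite EF.
Qed.

Lemma cond_quantile_law C : measurable C ->
  (mu \x lambda01 R)%E ((fun p : X * R => (p.1, cond_quantile p)) @^-1` C) = rho C.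
Proof.
move=> mC; have H A t : measurable A ->
    (mu \x lambda01 R)%E (Psi @^-1` (A `*` [set` `]-oo, t[])) =
    rho (A `*` [set` `]-oo, t[]).
  move=> mA; have [t0|t0] := leP t 0.
    rewrite below_null// -(measure0 (mu \x lambda01 R)%E).
    congr ((mu \x lambda01 R)%E _).
    apply/seteqP; split => // -[x u] [/= _]; rewrite in_itv/= => lt.
    by move: (lt_le_trans lt t0); rewrite ltNge cond_quantile_ge0.
  have [t1|t1] := leP t 1; first exact: middle.
  rewrite above_full// -[RHS]mule1 -(probability_setT (lambda01 R)) -product_measure1E//.
  congr ((mu \x lambda01 R)%E _).
  apply/seteqP; split => -[x u] [/= Ax _]; split => //=.
  by rewrite in_itv/= (le_lt_trans _ t1)//; have /andP[] := cond_quantile_le1 (x, u).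
apply: (measure_eq_rectangle_rays
  (m1 := law (mu \x lambda01 R)%E measurable_fun_quantile_graph)) mC => //.
by rewrite -ge0_fin_numE// fin_num_measure.
Qed.

End conditional_quantile.

(** * Conditional distribution functions from Radon-Nikodym densities *)

(** Over the set where [g < f] the integral of [f - g] is both nonnegative and nonpositive, so
    [f - g] vanishes almost everywhere on a set where it is nowhere zero. *)
Lemma integral_le_null_gt (R : realType) d (X : measurableType d)
    (mu : probability X R) (f g : X -> R) :
  mu.-integrable setT (EFin \o f) -> mu.-integrable setT (EFin \o g) ->
  (forall A, measurable A ->
    \int[mu]_(x in A) (f x)%:E <= \int[mu]_(x in A) (g x)%:E)%E ->
  measurable [set x | g x < f x] /\ mu [set x | g x < f x] = 0%E.
Proof.
move=> intf intg le_fg; set A := [set x | _].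
have mA : measurable A.
  apply: measurable_bool_set; apply: measurable_fun_ltr;
    exact/measurable_EFinP/(measurable_int mu).
split => //.
have intfA : mu.-integrable A (EFin \o f) by exact: integrableS intf.
have intgA : mu.-integrable A (EFin \o g) by exact: integrableS intg.
have intB : mu.-integrable A (fun x => (f x)%:E - (g x)%:E)%E by exact: integrableB.
have : (\int[mu]_(x in A) `|(f x)%:E - (g x)%:E| = 0)%E.
  rewrite (eq_integral (fun x => (f x)%:E - (g x)%:E)%E); last first.
    by move=> x /set_mem fg; rewrite gee0_abs// -EFinB lee_fin subr_ge0 ltW.
  apply/eqP; rewrite eq_le; apply/andP; split; last first.
    by apply: integral_ge0 => x; rewrite /A/= => fg; rewrite -EFinB lee_fin subr_ge0 ltW.
  rewrite integralB//= sube_le0; exact: le_fg.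
move=> /(ae_eq_integral_abs mu mA (measurable_int mu intB))[N [mN N0 sub]].
apply/eqP; rewrite eq_le measure_ge0 andbT -N0.
apply: le_measure; rewrite ?inE// => x Ax; apply: sub => /= /(_ Ax).
rewrite -EFinB => -[] /eqP; rewrite subr_eq0 => /eqP E.
by move: Ax; rewrite /A /= E ltxx.
Qed.

Section conditional_density.
Context (R : realType) d d' (X : measurableType d) (Z : measurableType d').
Variables (rho : probability Z R) (f : Z -> X) (mf : measurable_fun setT f).
Variables (B : set Z) (mB : measurable B).

Let nu (A : set X) : \bar R := rho (f @^-1` A `&` B).

Let nu0 : nu set0 = 0%E. Proof. by rewrite /nu preimage_set0 set0I measure0. Qed.

Let nu_ge0 A : (0 <= nu A)%E. Proof. exact: measure_ge0. Qed.

Let nu_additive : semi_sigma_additive nu.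
Proof.
move=> F mF tF mUF; rewrite /nu preimage_bigcup setI_bigcupl.
apply: measure_semi_sigma_additive.
- by move=> n; apply: measurableI => //; exact: measurable_preim.
- apply/trivIsetP => i j _ _ ij; rewrite setIACA -preimage_setI.
  by move/trivIsetP : tF => -> //; rewrite preimage_set0 set0I.
- rewrite -setI_bigcupl -preimage_bigcup.
  by apply: measurableI => //; exact: measurable_preim.
Qed.

HB.instance Definition _ := isMeasure.Build _ _ _ nu nu0 nu_ge0 nu_additive.

Let nu_fin : fin_num_fun nu.
Proof.
move=> A mA; apply: fin_num_measure.
by apply: measurableI => //; exact: measurable_preim.
Qed.

HB.instance Definition _ := Measure_isFinite.Build _ _ _ nu nu_fin.

Variable mu : probability X R.
Hypothesis rho_f : forall A, measurable A -> rho (f @^-1` A) = mu A.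

(** The conditional probability of [B] given [f]: the set function [nu] lies below the image of
    [rho] under [f], which is [mu], and is therefore dominated by it. *)
Lemma conditional_density : exists g : X -> R,
  [/\ forall x, 0 <= g x, mu.-integrable setT (EFin \o g) &
      forall A, measurable A ->
        rho (f @^-1` A `&` B) = (\int[mu]_(x in A) (g x)%:E)%E].
Proof.
have dom : nu `<< mu.
  apply/null_content_dominatesP => A mA muA; apply/eqP.
  have mA' : measurable (f @^-1` A) by exact: measurable_preim.
  have rho0 : rho (f @^-1` A) = 0%E by rewrite rho_f//; exact: muA.
  rewrite eq_le measure_ge0 andbT -rho0.
  by apply: le_measure; rewrite ?inE//; exact: measurableI.
pose g := Radon_Nikodym_SigmaFinite.f nu mu.
have gE x : g x = (fine (g x))%:E.
  by rewrite fineK//; exact: Radon_Nikodym_SigmaFinite.f_fin_num.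
exists (fine \o g); split => [x||A mA].
- by apply: fine_ge0; exact: Radon_Nikodym_SigmaFinite.f_ge0.
- rewrite (_ : _ \o _ = g); first exact: Radon_Nikodym_SigmaFinite.f_integrable.
  by apply/funext => x /=; rewrite -gE.
- rewrite [LHS](Radon_Nikodym_SigmaFinite.f_integral dom mA).
  by apply: eq_integral => x _ /=; rewrite -gE.
Qed.

End conditional_density.

Section conditional_cdf.
Context (R : realType) d (X : measurableType d).
Variables (mu : probability X R) (rho : probability (X * R)%type R).
Local Notation q := (rational_seq R).
Hypothesis rho_fst : forall A, measurable A -> rho (A `*` setT) = mu A.

Lemma conditional_cdf : exists h : nat -> X -> R,
  [/\ forall n, measurable_fun setT (h n),
      forall n x, 0 <= h n x <= 1,
      forall m n x, q m <= q n -> h m x <= h n x &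
      forall n A, measurable A ->
        rho (A `*` [set` `]-oo, q n]]) = (\int[mu]_(x in A) (h n x)%:E)%E].
Proof.
have mray n : measurable ([set: X] `*` [set` `]-oo, q n]]) by exact: measurableX.
have rayE n A : fst @^-1` A `&` ([set: X] `*` [set` `]-oo, q n]]) = A `*` [set` `]-oo, q n]].
  by apply/seteqP; split => -[x y] /= [] // ? [].
have rho_fst' A : measurable A -> rho (fst @^-1` A) = mu A.
  by move=> mA; rewrite -rho_fst//; congr (rho _); apply/seteqP; split => -[x y] // [].
have [g gP] := choice (fun n => conditional_density measurable_fst (mray n) rho_fst').
have g0 n x : 0 <= g n x by have [] := gP n.
have ig n : mu.-integrable setT (EFin \o g n) by have [] := gP n.
have gE n A : measurable A ->
    rho (A `*` [set` `]-oo, q n]]) = (\int[mu]_(x in A) (g n x)%:E)%E.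
  by move=> mA; have [_ _ /(_ A mA)] := gP n; rewrite rayE.
have mg n : measurable_fun setT (g n) by exact/measurable_EFinP/(measurable_int mu).
pose bad x := exists n, (1 < g n x) \/ exists m, q m <= q n /\ g n x < g m x.
have icst : mu.-integrable setT (EFin \o cst (1 : R)).
  exact: finite_measure_integrable_cst.
have gt1 n : measurable [set x | 1 < g n x] /\ mu [set x | 1 < g n x] = 0%E.
  apply: (integral_le_null_gt (ig n) icst) => A mA.
  rewrite -gE// [leRHS](_ : _ = rho (A `*` setT)); last first.
    by rewrite rho_fst// [LHS](integral_cst _ mA 1%E) mul1e.
  by apply: le_measure; rewrite ?inE; [exact: measurableX|exact: measurableX|move=> ? []].
have dec m n : q m <= q n ->
    measurable [set x | g n x < g m x] /\ mu [set x | g n x < g m x] = 0%E.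
  move=> mn; apply: (integral_le_null_gt (ig m) (ig n)) => A mA.
  rewrite -!gE//; apply: le_measure; rewrite ?inE; [exact: measurableX|exact: measurableX|].
  by move=> [x y] [/= Ax]; rewrite !in_itv/= => ym; split => //=; exact: le_trans mn.
pose N n m := [set x | q m <= q n /\ g n x < g m x].
have N0 n m : mu.-negligible (N n m).
  have [mn|/negP nmn] := boolP (q m <= q n).
    have [mN N0] := dec _ _ mn; apply: (@negligibleS _ _ _ mu [set x | g n x < g m x]).
      by move=> x [].
    by exists [set x | g n x < g m x]; split.
  by apply: (@negligibleS _ _ _ mu set0) => [x []//|]; exact: negligible_set0.
have bad0 : mu.-negligible [set x | bad x].
  rewrite (_ : mkset _ = \bigcup_n ([set x | 1 < g n x] `|` \bigcup_m N n m)).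
    apply: negligible_bigcup => n; apply: negligibleU.
      by have [? ?] := gt1 n; exists [set x | 1 < g n x]; split.
    exact: negligible_bigcup.
  apply/seteqP; split => x.
    by move=> [n [?|[m ?]]]; exists n => //; [left|right; exists m].
  by move=> [n _ [?|[m _ ?]]]; exists n; [left|right; exists m].
have [B [mB B0 badB]] := bad0.
(* The densities obey the bound by 1 and monotonicity only almost everywhere. Countably many
   exceptional sets are collected in the null set [B], and the constant 0 there meets every
   pointwise requirement. *)
pose h n x := if x \in B then 0 else g n x.
have mh n : measurable_fun setT (h n).
  apply: measurable_fun_ifT => //.
  apply: (measurable_fun_bool true); rewrite setTI (_ : _ @^-1` _ = B)//.
  by apply/seteqP; split => x => [/set_mem//|xB]; exact: mem_set.
have nbad x : x \notin B -> ~ bad x.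
  by move=> + b; rewrite notin_setE; apply; exact: badB.
exists h; split => // [n x|m n x mn|n A mA].
- rewrite /h; case: ifPn => [_|/nbad xB]; first by rewrite lexx ler01.
  rewrite g0/= leNgt; apply/negP => lt1; apply: xB; exists n; left; exact: lt1.
- rewrite /h; case: ifPn => // /nbad xB; rewrite leNgt; apply/negP => lt.
  by apply: xB; exists n; right; exists m.
- rewrite gE//; apply: ae_eq_integral => //.
  + by apply/measurable_EFinP; exact: measurable_funTS.
  + by apply/measurable_EFinP; exact: measurable_funTS.
  + exists B; split => // x /= nE; apply: contrapT => xB; apply: nE => _.
    by rewrite /h ifF//; apply/negbTE; rewrite notin_setE.
Qed.

End conditional_cdf.

(** * Conditional laws realised by a uniform variable *)

Section noise_outsourcing.
Context (R : realType) d1 d2 (X : measurableType d1) (Y : measurableType d2).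
Variables (mu : probability X R) (pi : probability (X * Y)%type R).
Hypothesis retY : real_retract R Y.
Hypothesis pi_fst : forall A, measurable A -> pi (A `*` setT) = mu A.

(** This stands in for a disintegration kernel: for uniform [u], the law of [y (x, u)] is a version
    of the conditional law given [x]. It is the quantile transform of [Y] encoded in the line,
    decoded again by [g]. *)
Lemma noise_outsourcing : exists y : X * R -> Y,
  measurable_fun setT y /\ forall C, measurable C ->
    (mu \x lambda01 R)%E ((fun p => (p.1, y p)) @^-1` C) = pi C.
Proof.
have [f [g [[mf mg fg] f01]]] := retY.
have mF : measurable_fun setT (fun z : X * Y => (z.1, f z.2)).
  by apply: measurable_fun_pair => //; exact: measurableT_comp.
pose rho := law pi mF.
have rho_fst A : measurable A -> rho (A `*` setT) = mu A.
  by move=> mA; rewrite lawE -pi_fst//; congr (pi _); apply/seteqP; split => -[x y] [].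
have rho01 : rho (setT `*` ~` [set` `[0, 1]]) = 0%E.
  rewrite lawE -[RHS](measure0 pi); congr (pi _).
  by apply/seteqP; split => // -[x y] [_] /=; rewrite in_itv/= f01.
have [h [mh h01 h_mono rho_h]] := conditional_cdf rho_fst.
have mQ := measurable_cond_quantile mh.
exists (fun p => g (cond_quantile h p)); split; first exact: measurableT_comp.
move=> C mC; pose k (p : X * R) := (p.1, g p.2).
have mk : measurable_fun setT k.
  by apply: measurable_fun_pair => //; exact: measurableT_comp.
have mkC : measurable (k @^-1` C) by exact: measurable_preim.
rewrite -[LHS]/((mu \x lambda01 R)%E ((fun p => (p.1, cond_quantile h p)) @^-1` (k @^-1` C))).
rewrite (cond_quantile_law h01 mh h_mono rho_fst rho01 rho_h mkC) lawE.
by congr (pi _); apply/seteqP; split => -[x y]; rewrite /k/= fg.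
Qed.

End noise_outsourcing.

Section quantile_inverse.
Context (R : realType) d (X : measurableType d) (h : nat -> X -> R) (x : X).
Local Notation q := (rational_seq R).
Variable P : probability R R.
Hypothesis P_h : forall n, P [set` `]-oo, q n]] = (h n x)%:E.
Hypothesis P01 : P [set` `[0, 1]] = 1%E.
Hypothesis P_diffuse : forall t, P [set t] = 0%E.

(** Rationals below the quantile [Q] have distribution function at most [u], those above it at least
    [u]. Passing to the limit gives the two inequalities; in the first, diffuseness allows the
    endpoint [Q] to be dropped. *)
Lemma cdf_cond_quantile (u : R) : 0 < u < 1 ->
  P [set` `]-oo, cond_quantile h (x, u)]] = u%:E.
Proof.
move=> /andP[u0 u1]; set Q := cond_quantile h (x, u).
have h_mono m n : q m <= q n -> h m x <= h n x.
  move=> mn; rewrite -lee_fin -!P_h; apply: le_measure; rewrite ?inE//.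
  by move=> t /=; rewrite !in_itv/= => /le_trans; apply.
have Pneg n : q n < 0 -> h n x = 0.
  move=> n0; apply: EFin_inj; rewrite -P_h; apply/eqP; rewrite eq_le measure_ge0 andbT.
  have -> : 0%:E = P (~` [set` `[0, 1]]) by rewrite probability_setC// P01 subee.
  apply: le_measure; rewrite ?inE//; first exact: measurableC.
  move=> t /=; rewrite !in_itv/= => tn /andP[t0 _].
  by move: (le_lt_trans tn n0); rewrite ltNge t0.
have Pone n : 1 <= q n -> h n x = 1.
  move=> n1; apply: EFin_inj; rewrite -P_h; apply/eqP; rewrite eq_le probability_le1//=.
  rewrite -P01; apply: le_measure; rewrite ?inE//.
  by move=> t /=; rewrite !in_itv/= => /andP[_ /le_trans]; apply.
apply/eqP; rewrite eq_le; apply/andP; split.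
  rewrite -(@setUitv1 _ _ _ _ true)// measureU//; last first.
    by apply/seteqP; split => // t [/= + tQ]; rewrite tQ in_itv/= ltxx.
  rewrite [X in (_ + X)%E]P_diffuse adde0.
  pose E n : set R := if q n < Q then [set` `]-oo, q n]] else set0.
  have -> : [set` `]-oo, Q[] = \bigcup_n E n.
    apply/seteqP; split => t; rewrite /= ?in_itv/=.
      move=> /rational_seq_between[n /andP[tn nQ]].
      by exists n => //; rewrite /E nQ /= in_itv/= ltW.
    by move=> [n _]; rewrite /E; case: ifPn => //= nQ; rewrite in_itv/= => /le_lt_trans; apply.
  rewrite [leLHS]measure_bigcup_chain; last 2 first.
  - by move=> n; rewrite /E; case: ifPn.
  - move=> m n; rewrite /E; case: ifPn => _; last by left.
    case: ifPn => _; last by right.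
    by have [mn|/ltW nm] := leP (q m) (q n); [left|right] => t /=;
      rewrite !in_itv/= => /le_trans; apply.
  apply: ge_ereal_sup => _ [n _ <-]; rewrite /= /E.
  case: ifPn => nQ; last by rewrite measure0 lee_fin ltW.
  (* [cond_quantile_le] bounds by the maximum with 0, so negative rationals are treated apart; [P]
     has no mass below them. *)
  rewrite P_h lee_fin; have [n0|n0] := ltP (q n) 0; first by rewrite Pneg// ltW.
  rewrite leNgt; apply/negP => /ltW /cond_quantile_le.
  by rewrite -/Q max_r// leNgt nQ.
have uh n : Q < q n -> u <= h n x.
  (* From level 1 on [cond_quantile_ltP] may fail to apply, but there [P] has its full mass. *)
  move=> Qn; have [n1|n1] := leP 1 (q n); first by rewrite Pone// ltW.
  have [m [mn um]] : exists m, q m < q n /\ u <= h m x.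
    apply/(cond_quantile_ltP h) => //; last exact: ltW.
    by apply: le_lt_trans Qn; exact: cond_quantile_ge0.
  by apply: le_trans um (h_mono _ _ (ltW mn)).
pose F n : set R := if Q < q n then [set` `]q n, +oo[] else set0.
(* Complements turn a decreasing intersection of left rays into an increasing union of right
   rays. *)
rewrite -[[set` `]-oo, Q]]]setCK setCitvl probability_setC//.
have -> : [set` `]Q, +oo[] = \bigcup_n F n.
  apply/seteqP; split => t; rewrite /= ?in_itv/= ?andbT.
    move=> /rational_seq_between[n /andP[Qn nt]].
    by exists n => //; rewrite /F Qn /= in_itv/= andbT.
  move=> [n _]; rewrite /F; case: ifPn => //= Qn; rewrite in_itv/= andbT.
  exact: lt_trans.
rewrite [P _]measure_bigcup_chain; last 2 first.
- by move=> n; rewrite /F; case: ifPn.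
- move=> m n; rewrite /F; case: ifPn => _; last by left.
  case: ifPn => _; last by right.
  by have [mn|/ltW nm] := leP (q m) (q n); [right|left] => t /=;
    rewrite !in_itv/= !andbT; exact: le_lt_trans.
have sup_le : (ereal_sup (range (P \o F)) <= (1 - u)%:E)%E.
  apply: ge_ereal_sup => _ [n _ <-]; rewrite /= /F.
  case: ifPn => Qn; last by rewrite measure0 lee_fin subr_ge0 ltW.
  rewrite -[[set` `]q n, +oo[]]setCK setCitvr probability_setC// P_h -EFinB lee_fin.
  by rewrite lerB// uh.
have -> : (u%:E = 1 - (1 - u)%:E)%E by rewrite -EFinB; congr _%:E; ring.
exact: leeB.
Qed.

End quantile_inverse.

(** * The isomorphism that preserves the first coordinate *)

Section outsourcing_iso.
Context (R : realType) d1 d2 (X : measurableType d1) (Y : measurableType d2).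
Variables (mu : probability X R) (pi : probability (X * Y)%type R).
Hypothesis retX : real_retract R X.
Hypothesis retY : real_retract R Y.
Hypothesis pi_fst : forall A, measurable A -> pi (A `*` setT) = mu A.
Local Notation lam := (lambda01 R).
Local Notation q := (rational_seq R).

Section diffuse_conditional.
Variables (y : X * R -> Y) (phi : Y * R -> R) (psi : R -> Y * R).
Hypothesis my : measurable_fun setT y.
Hypothesis y_law : forall C, measurable C ->
  (mu \x lam)%E ((fun p => (p.1, y p)) @^-1` C) = pi C.
Hypothesis mphi : measurable_fun setT phi.
Hypothesis mpsi : measurable_fun setT psi.
Hypothesis phiK : cancel phi psi.
Hypothesis phi01 : forall z, 0 <= phi z <= 1.

Let xi x (p : R * R) : R := phi (y (x, p.1), p.2).

Let mxi x : measurable_fun setT (xi x).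
Proof.
apply: measurableT_comp => //; apply: measurable_fun_pair => //.
apply: measurableT_comp => //; exact: measurable_fun_pair.
Qed.

(** A version of the conditional law of [phi (y, w)] given [x]. Being the law of a function of two
    independent uniform variables, it is a probability for every [x], not just for almost every
    one. *)
Let P x : probability R R := law (lam \x lam)%E (mxi x).

Let G x t : R := fine (P x [set` `]-oo, t]]).

Let GE x t : P x [set` `]-oo, t]] = (G x t)%:E.
Proof. by rewrite fineK// fin_num_measure. Qed.

Let PE x t : P x [set` `]-oo, t]] =
  (\int[lam]_u lam [set w | (phi (y (x, u), w) <= t)%R])%E.
Proof.
rewrite lawE /product_measure1; apply: eq_integral => u _ /=.
congr (lam _); apply/seteqP; split => w; rewrite /xsection /= inE /= in_itv/=//.
Qed.

(** Joint measurability is required because [theta'] evaluates [G] at a level that varies with the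
    point. The level is carried as a parameter through two integrations, over [w] and then over
    [u]. *)
Let measurable_G : measurable_fun setT (fun p : X * R => G p.1 p.2).
Proof.
apply: (measurableT_comp (fine_measurable measurableT)).
pose S := [set z : ((X * R) * R) * R | phi (y (z.1.1.1, z.1.2), z.2) <= z.1.1.2].
have mS : measurable S.
  apply: measurable_bool_set; apply: measurable_fun_ler; last first.
    by do 2!apply: measurableT_comp => //.
  apply: measurableT_comp => //; apply: measurable_fun_pair => //.
  apply: measurableT_comp => //; apply: measurable_fun_pair => //; last exact: measurableT_comp.
  by do 2!apply: measurableT_comp => //.
have mF := measurable_fun_xsection lam mS.
have := @measurable_fun_fubini_tonelli_F _ _ _ _ _ lam _ mF (fun=> measure_ge0 _ _).
rewrite (_ : fubini_F _ _ = fun p : X * R => P p.1 [set` `]-oo, p.2]]); first exact.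
apply/funext => p; rewrite PE /fubini_F; apply: eq_integral => u _ /=.
by congr (lam _); apply/seteqP; split => w; rewrite /xsection /= inE.
Qed.

Let h n x := G x (q n).

Let mh n : measurable_fun setT (h n).
Proof.
apply: (@measurableT_comp _ _ _ _ _ _ (fun p : X * R => G p.1 p.2) setT (fun x => (x, q n))) => //.
Qed.

Let h01 n x : 0 <= h n x <= 1.
Proof. by rewrite -!lee_fin -GE measure_ge0 probability_le1. Qed.

Let h_mono m n x : q m <= q n -> h m x <= h n x.
Proof.
move=> mn; have le : (P x [set` `]-oo, q m]] <= P x [set` `]-oo, q n]])%E.
  apply: le_measure; [exact: mem_set|exact: mem_set|].
  by move=> t /=; rewrite !in_itv/= => /le_trans; apply.
by move: le; rewrite (GE x (q m)) (GE x (q n)) lee_fin.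
Qed.

Let encode (z : (X * Y) * R) : X * R := (z.1.1, phi (z.1.2, z.2)).

Let mencode : measurable_fun setT encode.
Proof.
apply: measurable_fun_pair; first exact: measurableT_comp.
apply: measurableT_comp => //; apply: measurable_fun_pair => //.
exact: measurableT_comp.
Qed.

Let rho : probability (X * R)%type R := law (pi \x lam)%E mencode.

Let rho_fst A : measurable A -> rho (A `*` setT) = mu A.
Proof.
move=> mA; rewrite lawE (_ : encode @^-1` _ = (A `*` setT) `*` setT).
  transitivity (pi (A `*` setT) * lam setT)%E.
    by apply: product_measure1E => //; exact: measurableX.
  by rewrite probability_setT mule1 pi_fst.
by apply/seteqP; split => -[[x z] w] /= [] // [].
Qed.

Let rho01 : rho (setT `*` ~` [set` `[0, 1]]) = 0%E.
Proof.
rewrite lawE -[RHS](measure0 (pi \x lam)%E); congr ((pi \x lam)%E _).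
by apply/seteqP; split => // -[[x z] w] [_] /=; rewrite in_itv/= phi01.
Qed.

(** By [y_law], [pi] may be replaced by the law of [(x, y (x, u))]; Fubini then exhibits the
    distribution function of [P x] inside the integral over [x]. *)
Let rho_h n A : measurable A ->
  rho (A `*` [set` `]-oo, q n]]) = (\int[mu]_(x in A) (h n x)%:E)%E.
Proof.
move=> mA; rewrite lawE.
set S := encode @^-1` _.
have mS : measurable S by apply: measurable_preim => //; exact: measurableX.
have mS' := measurable_fun_xsection lam mS.
have mgr : measurable_fun setT (fun p : X * R => (p.1, y p)) by exact: measurable_fun_pair.
transitivity (\int[law (mu \x lam)%E mgr]_z (lam \o xsection S) z)%E.
  by apply: eq_measure_integral => C mC _; exact: esym (y_law mC).
transitivity (\int[(mu \x lam)%E]_p (lam \o xsection S) (p.1, y p))%E.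
  by rewrite ge0_integral_distribution.
rewrite fubini_tonelli1//; last exact: measurableT_comp.
rewrite [RHS]integral_mkcond; apply: eq_integral => x _.
rewrite /fubini_F patchE; case: ifPn => xA.
  rewrite -GE PE; apply: eq_integral => u _ /=; congr (lam _).
  apply/seteqP; split => w; rewrite /xsection /= inE /S /encode/= in_itv/=; first by case.
  by rewrite inE in xA.
apply: integral0_eq => u _ /=; rewrite -[RHS](measure0 lam); congr (lam _).
apply/seteqP; split => // w; rewrite /xsection /= inE => -[Ax _].
by move: xA; rewrite notin_setE.
Qed.

Let Q := cond_quantile h.

Let decoded (p : X * R) : (X * Y) * R := ((p.1, (psi p.2).1), (psi p.2).2).

Let mdecoded : measurable_fun setT decoded.
Proof.
have m2 : measurable_fun setT (fun p : X * R => psi p.2) by exact: measurableT_comp.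
by apply: measurable_fun_pair; [apply: measurable_fun_pair|] => //; exact: measurableT_comp.
Qed.

Let theta (p : X * R) : (X * Y) * R := decoded (p.1, Q p).
Let theta' (z : (X * Y) * R) : X * R := (z.1.1, G z.1.1 (phi (z.1.2, z.2))).

Let mtheta : measurable_fun setT theta.
Proof.
by apply: measurableT_comp => //; exact: measurable_fun_quantile_graph.
Qed.

Let mtheta' : measurable_fun setT theta'.
Proof.
have m1 : measurable_fun setT (fun z : (X * Y) * R => z.1.1) by exact: measurableT_comp.
by apply: measurable_fun_pair => //; exact: (measurableT_comp measurable_G mencode).
Qed.

(** For each [u], injectivity of [phi] leaves [(psi t).2] as the only possible [w], and a point is
    null for [lam]. *)
Let P_diffuse x t : P x [set t] = 0%E.
Proof.
rewrite lawE /product_measure1; apply: integral0_eq => u _ /=.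
apply/eqP; rewrite eq_le measure_ge0 andbT -(lambda01_set1 (psi t).2).
apply: le_measure; rewrite ?inE//.
  by apply: measurable_xsection; apply: measurable_preim.
by move=> w; rewrite /xsection /= inE /xi /= => <-; rewrite phiK.
Qed.

Let P01 x : P x [set` `[0, 1]] = 1%E.
Proof.
rewrite lawE -(probability_setT (lam \x lam)%E); congr ((lam \x lam)%E _).
by apply/seteqP; split => // p _; rewrite /= in_itv/= phi01.
Qed.

Let GQ x u : 0 < u < 1 -> G x (Q (x, u)) = u.
Proof.
move=> u01; apply: EFin_inj; rewrite -GE.
exact: cdf_cond_quantile.
Qed.

Let quantile_law C : measurable C ->
  (mu \x lam)%E ((fun p => (p.1, Q p)) @^-1` C) = rho C.
Proof. exact: cond_quantile_law. Qed.

(** Cancellation can fail in two ways. The quantile may miss the range of [phi] ([N1]), which is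
    null because its joint law with [x] is that of an encoded point; or [u] may lie outside the open
    unit interval ([N2]), where [GQ] says nothing. *)
Let thetaK_null : (mu \x lam)%E [set p | theta' (theta p) <> p] = 0%E.
Proof.
pose N1 : set (X * R) := [set p | phi (psi p.2) <> p.2].
have mN1 : measurable N1.
  apply: measurableC; apply: (measurable_eq_set (real_retract_real R)) => //.
  by do 2!apply: measurableT_comp => //.
pose N2 : set (X * R) := setT `*` ~` [set` `]0, 1[].
have mN2 : measurable N2 by apply: measurableX => //; exact: measurableC.
have mN1' : measurable ((fun p => (p.1, Q p)) @^-1` N1).
  by apply: measurable_preim => //; exact: measurable_fun_quantile_graph.
have N10 : (mu \x lam)%E ((fun p => (p.1, Q p)) @^-1` N1) = 0%E.
  rewrite quantile_law// lawE -[RHS](measure0 (pi \x lam)%E).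
  congr ((pi \x lam)%E _); apply/seteqP; split => // z.
  by rewrite /N1 /encode /= phiK.
have N20 : (mu \x lam)%E N2 = 0%E.
  have lam1 : lam [set` `]0, 1[] = 1%E.
    rewrite /lambda01 /mrestr setIidl; last first.
      by move=> t /=; rewrite /unit_itv /= !in_itv/= => /andP[/ltW-> /ltW->].
    by rewrite lebesgue_measure_itv/= lte_fin ltr01 sube0.
  transitivity (mu setT * lam (~` [set` `]0%R, 1%R[]))%E.
    by apply: product_measure1E => //; exact: measurableC.
  by rewrite [X in (_ * X)%E](probability_setC (lambda01 R))// [X in (_ - X)%E]lam1 subee// mule0.
apply/eqP; rewrite eq_le measure_ge0 andbT.
apply: (@le_trans _ _ ((mu \x lam)%E ((fun p => (p.1, Q p)) @^-1` N1 `|` N2))).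
  apply: le_measure; rewrite ?inE//.
  - apply: measurableC.
    apply: (measurable_eq_set (real_retractX retX (real_retract_real R))).
      exact: measurableT_comp mtheta' mtheta.
    exact: measurable_id.
  - exact: measurableU.
  - move=> [x u] ne; have [Qx|Qx] := pselect (phi (psi (Q (x, u))) = Q (x, u)); last by left.
    right; split => //= u01; apply: ne.
    rewrite /theta' /theta /decoded/= -surjective_pairing Qx GQ//.
apply: le_trans (measureU2 _ mN1' mN2) _.
by rewrite [X in (X + _)%E]N10 [X in (_ + X)%E]N20 adde0.
Qed.

Lemma diffuse_outsourcing_iso :
  exists (theta : X * R -> (X * Y) * R) (theta' : (X * Y) * R -> X * R),
  ae_iso (mu \x lam)%E (pi \x lam)%E theta theta' /\
  forall p, (theta p).1.1 = p.1.
Proof.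
exists theta, theta'; split => //; split => // C mC.
have mdC : measurable (decoded @^-1` C) by exact: measurable_preim.
rewrite -[LHS]/((mu \x lam)%E ((fun p => (p.1, Q p)) @^-1` (decoded @^-1` C))).
rewrite quantile_law// lawE; congr ((pi \x lam)%E _).
by apply/seteqP; split => -[[x z] w]; rewrite /encode /decoded /= phiK.
Qed.

End diffuse_conditional.

Lemma outsourcing_iso :
  exists (theta : X * R -> (X * Y) * R) (theta' : (X * Y) * R -> X * R),
  ae_iso (mu \x lam)%E (pi \x lam)%E theta theta' /\
  forall p, (theta p).1.1 = p.1.
Proof.
have [y [my y_law]] := noise_outsourcing retY pi_fst.
have [phi [psi [[mphi mpsi phiK] phi01]]] := real_retractX retY (real_retract_real R).
exact: (diffuse_outsourcing_iso my y_law mphi mpsi phiK phi01).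
Qed.

End outsourcing_iso.

(** * Gluing the isomorphisms over the two factors *)

Section swap_iso.
Context (R : realType) d1 d2 (X : measurableType d1) (Y : measurableType d2).
Variable pi : probability (X * Y)%type R.
Local Notation lam := (lambda01 R).

Lemma ae_iso_swap_noise :
  ae_iso (pi \x lam)%E (law pi (@measurable_swap _ _ X Y) \x lam)%E
    (fun z : (X * Y) * R => (unstable.swap z.1, z.2)) (fun z : (Y * X) * R => (unstable.swap z.1, z.2)).
Proof.
have msw d d' (T : measurableType d) (T' : measurableType d') :
    measurable_fun setT (fun z : (T * T') * R => (unstable.swap z.1, z.2)).
  apply: measurable_fun_pair => //; apply: measurableT_comp => //.
  exact: measurable_swap.
split; [exact: msw|exact: msw|move=> C mC|].
- have mC' := measurable_fun_xsection lam mC.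
  transitivity (\int[law pi (@measurable_swap _ _ X Y)]_z (lam \o xsection C) z)%E => //.
  rewrite ge0_integral_distribution//; apply: eq_integral => -[x y] _ /=; congr (lam _).
- rewrite -[RHS](measure0 (pi \x lam)%E); congr ((pi \x lam)%E _).
  by apply/seteqP; split => // -[[x y] w] /=; apply.
Qed.

End swap_iso.

(** The map is [eta'] after the swap after [theta]. Since [eta] keeps [y], so does [eta'] wherever
    [eta] undoes it; hence [(f p).1] is almost surely the [Y] coordinate of [theta p]. As [theta]
    keeps [x] and transports the measure to [pi \x lambda01 R], the pair has law [pi]. *)
Lemma coupling_ae_iso (R : realType) d1 d2 (X : measurableType d1)
    (Y : measurableType d2) (mu : probability X R) (nu : probability Y R)
    (pi : probability (X * Y)%type R) :
  real_retract R X -> real_retract R Y -> coupling mu nu pi ->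
  exists (f : X * R -> Y * R) (f' : Y * R -> X * R),
    ae_iso (mu \x lambda01 R)%E (nu \x lambda01 R)%E f f' /\
    forall C, measurable C ->
      (mu \x lambda01 R)%E [set p | C (p.1, (f p).1)] = pi C.
Proof.
move=> retX retY [pi_fst pi_snd].
have retR := real_retract_real R.
have ret3 := real_retractX (real_retractX retX retY) retR.
have ret3' := real_retractX (real_retractX retY retX) retR.
pose pi' := law pi (@measurable_swap _ _ X Y).
have [|theta [theta' [isot theta1]]] := @outsourcing_iso R _ _ X Y mu pi retX retY.
  by move=> A mA; rewrite -pi_fst// /pushforward; congr (pi _);
    apply/seteqP; split => -[x y] // [].
have [|eta [eta' [isoe eta1]]] := @outsourcing_iso R _ _ Y X nu pi' retY retX.
  by move=> B mB; rewrite -pi_snd// lawE /pushforward; congr (pi _);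
    apply/seteqP; split => -[x y] // [].
have isoe' := ae_iso_sym (real_retractX retY retR) ret3' isoe.
pose sw (z : (X * Y) * R) := (unstable.swap z.1, z.2).
have isos := ae_iso_comp (real_retractX retX retR) ret3 isot (ae_iso_swap_noise pi).
have iso := ae_iso_comp (real_retractX retX retR) ret3' isos isoe'.
eexists; eexists; split; first exact: iso.
move=> C mC; rewrite -/sw.
have [mt _ tP _] := isot; have [ms _ sP _] := isos; have [mf _ _ _] := iso.
have [me' me eP ee'] := isoe'.
pose N := [set z | eta (eta' z) <> z].
have mN : measurable N := measurable_neq_set ret3' me' me.
have mCT : measurable (C `*` [set: R]) by exact: measurableX.
transitivity ((mu \x lambda01 R)%E (theta @^-1` (C `*` setT))).
  apply: (@measure_eq_mod_null R _ _ (mu \x lambda01 R)%E ((sw \o theta) @^-1` N)).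
  - exact: measurable_preim.
  - by rewrite sP.
  - apply: (measurable_preim (f := fun p : X * R => (p.1, (eta' (sw (theta p))).1))) => //.
    by apply: measurable_fun_pair => //; exact: measurableT_comp.
  - exact: measurable_preim.
  - move=> p /contrapT /= E; rewrite -theta1 -eta1 E /=.
    by rewrite -surjective_pairing; split => // -[].
rewrite tP//; transitivity (pi C * lambda01 R setT)%E; first exact: product_measure1E.
by rewrite probability_setT mule1.
Qed.

Theorem theorem2p1 (R : realType) (d1 d2 : measure_display)
  (X : measurableType d1) (Y : measurableType d2)
  (hX : standard_borel R X) (hY : standard_borel R Y)
  (hXunc : ~ countable [set: X]) (hYunc : ~ countable [set: Y])
  (mu : probability X R) (nu : probability Y R)
  (pi : probability (prod X Y) R) (hpi : coupling mu nu pi) :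
  exists T : X * R -> Y * R,
    [/\ measurable_fun (setT `*` unit_itv R) T,
        set_bij (setT `*` unit_itv R) (setT `*` unit_itv R) T,
        (forall B, measurable B ->
           pushforward (mu \x lambda01 R)%E T B = (nu \x lambda01 R)%E B) &
        let pihat := pushforward (mu \x lambda01 R)%E
                       (fun xs : X * R => (xs, T xs)) in
        forall C, measurable C ->
          pushforward pihat
            (fun z : (X * R) * (Y * R) => (z.1.1, z.2.1)) C = pi C].
Proof.
have retX := standard_borel_real_retract hX.
have retY := standard_borel_real_retract hY.
have retR := real_retract_real R.
have [f [f' [iso f_law]]] := coupling_ae_iso retX retY hpi.
have [k [k' [K [[mk mk' kK] kK01 k01 mK K0]]]] := null_real_embedding R.
have mI : measurable (unit_itv R) by exact: measurable_unit_itv.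
have I0 : lambda01 R (~` unit_itv R) = 0%E.
  by rewrite /lambda01 /mrestr setICl measure0.
have null_strip d (Z : measurableType d) (P : probability Z R) (J : set R) :
    measurable J -> lambda01 R J = 0%E -> (P \x lambda01 R)%E (setT `*` J) = 0%E.
  move=> mJ J0; transitivity (P setT * lambda01 R J)%E; first exact: product_measure1E.
  by rewrite J0 mule0.
have stripC d (Z : measurableType d) : ~` ([set: Z] `*` unit_itv R) = setT `*` ~` unit_itv R.
  by apply/seteqP; split => -[x t] /= => [H|[_ H] []//]; split => // It; apply: H.
(* The whole of [Z] is placed in the single fibre over [point], at heights in [K]; it thus lies in
   the unit strip and in a null set at once. *)
have embed d d' (Z : measurableType d) (Z' : measurableType d') :
    real_retract R Z -> exists (i : Z -> Z' * R) (i' : Z' * R -> Z),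
    measurable_retraction i i' /\
    forall p, ([set: Z'] `*` unit_itv R) (i p) /\ ([set: Z'] `*` K) (i p).
  move=> [a [b [[ma mb ab] _]]].
  exists (fun p => (point, k (a p))), (fun p => b (k' p.2)); split; last first.
    by move=> p; split; split => //=; rewrite /unit_itv /= in_itv/= k01.
  split.
  - by apply: measurable_fun_pair; [exact: measurable_cst|exact: measurableT_comp].
  - by do 2!apply: measurableT_comp => //.
  - by move=> p /=; rewrite kK ab.
have retS := real_retractX retX retR; have retS' := real_retractX retY retR.
have [i [i' [reti iP]]] := embed _ _ _ Y retS.
have [j [j' [retj jP]]] := embed _ _ _ X retS'.
have mS d (Z : measurableType d) (J : set R) : measurable J -> measurable ([set: Z] `*` J).
  by move=> mJ; exact: measurableX.
(* Rectification between the unit strips, with the strips over [K] as the null sets that receive the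
   embedded spaces. *)
have [T [N [mT bijT mN N0 TN]]] : exists (T : X * R -> Y * R) (N : set (X * R)),
    [/\ measurable_fun setT T, set_bij (setT `*` unit_itv R) (setT `*` unit_itv R) T,
        measurable N, (mu \x lambda01 R)%E N = 0%E & forall p, ~ N p -> T p = f p].
  apply: (ae_iso_rectify retS retS' iso _ _ _ _ _ _ _ _ reti retj iP jP);
    rewrite ?stripC; try exact: mS; apply: null_strip => //; exact: measurableC.
have [mf _ fP _] := iso.
exists T; split => //; first exact: measurable_funTS.
- move=> B mB; rewrite -fP//; apply: (measure_eq_mod_null mN N0).
  + exact: measurable_preim.
  + exact: measurable_preim.
  + by move=> p /TN /= ->.
- move=> /= C mC; rewrite -f_law//; apply: (measure_eq_mod_null mN N0).
  + apply: (measurable_preim (f := fun p : X * R => (p.1, (T p).1))) => //.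
    by apply: measurable_fun_pair => //; exact: measurableT_comp.
  + apply: (measurable_preim (f := fun p : X * R => (p.1, (f p).1))) => //.
    by apply: measurable_fun_pair => //; exact: measurableT_comp.
  + by move=> p /TN /= ->.
Qed.
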